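(* $\displaystyle \limsup_{d\to\infty} \frac{h_{**}(d)}{h_{\mathrm{as}}(d)} \leq 1.$
   Context: For $d \geq 3$, let $g(x,y)=\sum_{n\ge0}P_x[X_n=y]$ be the Green function of simple random walk on $\mathbb{Z}^d$, $g(0)=g(0,0)$. Under $\mathbb{P}$, $\varphi=(\varphi_x)_{x\in\mathbb{Z}^d}$ is a centered Gaussian field with $\mathbb{E}[\varphi_x\varphi_y]=g(x,y)$ (Gaussian free field). For $h\in\mathbb{R}$, $E_\varphi^{\geq h}=\{x:\varphi_x\ge h\}$. For $L\ge 1$, $B(0,L)$ is the $\ell^\infty$-ball of radius $L$ around $0$ and $S(0,2L)$ the $\ell^\infty$-sphere of radius $2L$ around $0$; $\{B(0,L)\stackrel{\ge h}{\longleftrightarrow}S(0,2L)\}$ is the event that there is a nearest-neighbour path in $E_\varphi^{\ge h}$ from $B(0,L)$ to $S(0,2L)$. Define $h_{**}(d)=\inf\{h\in\mathbb{R}:\lim_{L\to\infty}\mathbb{P}[B(0,L)\stackrel{\ge h}{\longleftrightarrow}S(0,2L)]=0\}$ and $h_{\mathrm{as}}(d)=\sqrt{2g(0)\log d}$. *)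

(* Defs.v *)
From HB Require Import structures.
From mathcomp Require Import all_boot all_order all_algebra.
From mathcomp Require Import all_classical all_reals all_analysis.
Unset Printing Implicit Defensive.
Import Order.TTheory GRing.Theory Num.Theory.
Import numFieldNormedType.Exports.
Local Open Scope classical_set_scope.
Local Open Scope ring_scope.

Definition Zd (d : nat) := {ffun 'I_d -> int}.

Definition orig (d : nat) : Zd d := [ffun => 0%R].

Definition zshift {d : nat} (x : Zd d) (i : 'I_d) (s : int) : Zd d :=
  [ffun j => x j + (if j == i then s else 0)].

Definition linf {d : nat} (x : Zd d) : nat := (\max_(i < d) absz (x i))%N.

Definition nnb {d : nat} (x y : Zd d) : bool :=
  ((\sum_(i < d) absz (x i - y i))%N == 1%N).

Section SRW.
Variable R : realType.

(* srw_p d n x y = P_x[X_n = y] for simple random walk on Z^d,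
   defined by the Markov property (one-step decomposition). *)
Fixpoint srw_p (d : nat) (n : nat) (x y : Zd d) {struct n} : R :=
  match n with
  | 0%N => if x == y then 1 else 0
  | n'.+1 => ((d *+ 2)%:R)^-1 *
        \sum_(i < d) (srw_p d n' (zshift x i 1) y + srw_p d n' (zshift x i (-1)) y)
  end.

Definition green (d : nat) (x y : Zd d) : \bar R :=
  (\sum_(0 <= n <oo) (srw_p d n x y)%:E)%E.

Definition g0 (d : nat) : R := fine (green d (orig d) (orig d)).

Definition centered_gauss_law (v : R) (A : set R) : \bar R :=
  if v == 0 then \d_(0:R) A else normal_prob 0 (Num.sqrt v) A.

Definition is_GFF {d : nat} {dT : measure_display} {T : measurableType dT}
    (P : probability T R) (phi : Zd d -> T -> R) : Prop :=
  (forall x, measurable_fun setT (phi x)) /\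
  forall (s : seq (Zd d * R)) (A : set R), measurable A ->
    P ((fun w => \sum_(p <- s) p.2 * phi p.1 w) @^-1` A) =
    centered_gauss_law
      (\sum_(p <- s) \sum_(q <- s) p.2 * q.2 * fine (green d p.1 q.1)) A.

Definition crossing {d : nat} {dT : measure_display} {T : measurableType dT}
    (phi : Zd d -> T -> R) (h : R) (L : nat) : set T :=
  [set w | exists (n : nat) (gam : nat -> Zd d),
      [/\ (linf (gam 0%N) <= L)%N, linf (gam n) = (2 * L)%N,
          (forall k, (k < n)%N -> nnb (gam k) (gam k.+1)) &
          (forall k, (k <= n)%N -> h <= phi (gam k) w)]].

Definition h_ss {d : nat} {dT : measure_display} {T : measurableType dT}
    (P : probability T R) (phi : Zd d -> T -> R) : \bar R :=
  ereal_inf [set (h%:E)%E | h in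
     [set h : R | (fun L : nat => P (crossing phi h L)) @ \oo --> 0%E]].

Definition h_as (d : nat) : R := Num.sqrt (2 * g0 d * ln (d%:R)).

(* the ratio h_**(d)/h_as(d), only meaningful for d >= 3 *)
Definition ratio_seq (dT : nat -> measure_display)
    (T : forall d, measurableType (dT d))
    (P : forall d, probability (T d) R) (phi : forall d, Zd d -> T d -> R)
    (d : nat) : \bar R :=
  if (3 <= d)%N then (h_ss (P d) (phi d) * ((h_as d)^-1)%:E)%E else 0%E.

End SRW.

Arguments is_GFF {R d dT T}.
Arguments crossing {R d dT T}.
Arguments h_ss {R d dT T}.
Arguments ratio_seq {R dT T}.

(* Main.v *)
Require Import Defs.
From HB Require Import structures.
From mathcomp Require Import all_boot all_order all_algebra.
From mathcomp Require Import all_classical all_reals all_analysis.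
From mathcomp Require Import measurable_realfun.
From mathcomp Require Import zify ring lra.
Import Order.TTheory GRing.Theory Num.Theory.
Import numFieldNormedType.Exports.
Local Open Scope ring_scope.

(** A cluster of l1-radius [4 ^ (k + 1) N] around [x] contains, for some [y] with
    [|x - y|_1 = 3 * 4 ^ k N], clusters of radius [4 ^ k N] around both [x] and
    [y]. Iterating, a cluster of radius [4 ^ k N] contains [2 ^ k] well separated
    self-avoiding paths of [N] sites, with [N] a small multiple of [d]. In high
    dimension the Green function is so small off the diagonal that these
    [2 ^ k N] sites are nearly independent, and a Gaussian bound for the sum of
    the field over them gives a probability [d ^ (- (1 + eps) 2 ^ k N)] at level
    [(1 + eps) h_as]. There are at most [(2 d) ^ (2 ^ k N)] choices for the paths,
    and [exp (O(d) 2 ^ k)] for the branch points because an l1-ball of radius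
    [C d] contains only [exp (O(d))] sites; as [N] is of order [d], the factor
    [d ^ (- eps N)] gained on each path beats both constants.

    The Green function is controlled through the number of steps [N_i] that
    the walk makes in direction [i]: the product of the one-dimensional
    probabilities is decreasing in the negatively correlated [N_i], which
    bounds the transition probabilities by a power [d] of a binomial average. *)

(** * Heat kernel and Green function *)

Section OneDim.
Variable R : realType.

Fixpoint srw1 (k : nat) (j : int) : R :=
  if k is k'.+1 then (srw1 k' (j + 1) + srw1 k' (j - 1)) / 2 else (j == 0)%:R.

Lemma srw1_out k j : (forall i : nat, j <> k%:Z - 2 * i%:Z) -> srw1 k j = 0.
Proof.
elim: k j => [|k IH] j H /=.
  by case: eqP => // j0; case: (H 0%N); lia.
rewrite !IH; first by rewrite addr0 mul0r.
- by move=> i e; apply: (H i); lia.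
- by move=> i e; apply: (H i.+1); lia.
Qed.

(** [i] counts the steps of one sign. For [i > k] both sides vanish, so this and [srw1_out] together
    cover every [j]. *)
Lemma srw1_bin k (i : nat) : srw1 k (k%:Z - 2 * i%:Z) = 'C(k, i)%:R / 2 ^+ k.
Proof.
elim: k i => [|k IH] [|i] /=.
- by rewrite bin0 expr0 divr1.
- by rewrite bin0n mul0r.
- rewrite (_ : _ - 1 = k%:Z - 2 * 0%:Z); last lia.
  rewrite IH !bin0 srw1_out; last by move=> i; lia.
  by rewrite add0r exprS invfM; field.
- rewrite (_ : _ - 1 = k%:Z - 2 * i.+1%:Z); last lia.
  rewrite (_ : _ + 1 = k%:Z - 2 * i%:Z); last lia.
  rewrite !IH binS natrD exprS invfM; field.
  by rewrite expf_neq0.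
Qed.

Lemma srw1_ge0 k j : 0 <= srw1 k j.
Proof.
elim: k j => [|k IH] j /=; first exact: ler0n.
by rewrite divr_ge0// addr_ge0.
Qed.

Lemma srw1_le_half k j : srw1 k.+1 j <= 1 / 2.
Proof.
elim: k j => [|k IH] j.
  by rewrite /=; case: eqP => h1; case: eqP => h2; try lia; rewrite ?mulr1n ?mulr0n; lra.
have h1 := IH (j + 1); have h2 := IH (j - 1).
rewrite -[srw1 k.+2 j]/((srw1 k.+1 (j + 1) + srw1 k.+1 (j - 1)) / 2); lra.
Qed.

Lemma srw1_le1 k j : srw1 k j <= 1.
Proof.
case: k => [|k]; first by rewrite /= lern1; case: eqP.
apply: le_trans (srw1_le_half _ _) _; lra.
Qed.

(** Squared form of ['C(2k, k) / 4^k <= (2k + 1)^(-1/2)]. Consecutive central coefficients have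
    ratio [2(2k + 1)/(k + 1)], and [(2k + 1)(2k + 3) <= 4(k + 1)^2]. *)
Lemma central_bin_le (k : nat) : ('C(2 * k, k) ^ 2 * (2 * k + 1) <= 16 ^ k)%N.
Proof.
elim: k => [//|k IH].
have e : (k.+1 * 'C(2 * k.+1, k.+1) = 2 * (2 * k + 1) * 'C(2 * k, k))%N.
  have := mul_bin_diag (2 * k).+2 k; have := mul_bin_down (2 * k).+1 k.
  rewrite (_ : (2 * k.+1)%N = (2 * k).+2)/=; last lia.
  rewrite (_ : ((2 * k).+1 - k)%N = k.+1); last lia.
  by move=> h1 <-; rewrite (_ : (2 * k).+2 = 2 * k.+1)%N -?mulnA -?h1; lia.
have : (k.+1 ^ 2 * ('C(2 * k.+1, k.+1) ^ 2 * (2 * k.+1 + 1)) <= k.+1 ^ 2 * 16 ^ k.+1)%N.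
  rewrite mulnA -expnMn e (expnS 16).
  have : ((2 * k + 1) * (2 * k.+1 + 1) <= 4 * k.+1 ^ 2)%N by lia.
  move: IH; set c := 'C(_, _); move: (16 ^ k)%N => D IH h.
  rewrite [leqLHS](_ : _ =
    (c ^ 2 * (2 * k + 1)) * (4 * ((2 * k + 1) * (2 * k.+1 + 1))))%N; last by ring.
  rewrite [leqRHS](_ : _ = D * (4 * (4 * k.+1 ^ 2)))%N; last by ring.
  by apply: leq_mul => //; rewrite leq_mul2l.
by rewrite leq_pmul2l ?expn_gt0.
Qed.

(** The square is one term of Vandermonde's sum for ['C(k + k, k)]. *)
Lemma bin_sqr_le (k i : nat) : ('C(k, i) ^ 2 <= 'C(2 * k, k))%N.
Proof.
case: (leqP i k) => ik; last by rewrite bin_small.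
rewrite mul2n -addnn -(binomial.Vandermonde k k k).
rewrite (bigD1 (Ordinal (ik : (i < k.+1)%N)))//= bin_sub//.
by rewrite -mulnn leq_addr.
Qed.

(** Decay of order [k^(-1/4)], weaker than the true [k^(-1/2)]: it comes from comparing ['C(k, i)^2]
    with ['C(2k, k)]. Any polynomial rate is enough once [d] coordinates are multiplied. *)
Lemma srw1_le4 k j : srw1 k j ^+ 4 * (2 * k%:R + 1) <= 1.
Proof.
have [[i ->]|H] := pselect (exists i : nat, j = k%:Z - 2 * i%:Z); last first.
  rewrite srw1_out ?expr0n ?mul0r//= => i e; apply: H; by exists i.
rewrite srw1_bin expr_div_n mulrAC ler_pdivrMr ?exprn_gt0//; last first.
rewrite mul1r -exprM mulnC exprM.
rewrite (_ : 2 ^+ 4 = 16%:R :> R); last by rewrite -natrX.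
rewrite -natrX -natrX -[2]/(2%:R) -[1]/(1%:R) -natrM -natrD -natrM ler_nat.
apply: leq_trans (central_bin_le k); rewrite leq_mul2r; apply/orP; right.
by rewrite (expnM _ 2 2) leq_sqr bin_sqr_le.
Qed.

End OneDim.

(** * Product structure of the walk on the d-dimensional lattice *)

Lemma weierstrass_prod (R : realType) (I : Type) (s : seq I) (a : I -> R) :
  (forall i, 0 <= a i <= 1) -> 1 - \sum_(i <- s) a i <= \prod_(i <- s) (1 - a i) <= 1.
Proof.
move=> a01; elim: s => [|i s /andP[IH1 IH2]].
  by rewrite !big_nil subr0 !lexx.
have S0 : 0 <= \sum_(j <- s) a j.
  by apply: sumr_ge0 => j _; case/andP: (a01 j).
have P0 : 0 <= \prod_(j <- s) (1 - a j).
  by apply: prodr_ge0 => j _; case/andP: (a01 j); lra.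
rewrite !big_cons; have /andP[h0 h1] := a01 i.
move: IH1 IH2 S0 P0; set S := \sum_(_ <- _) _; set Q := \prod_(_ <- _) _ => *.
apply/andP; split; nra.
Qed.

Lemma natr_double (R : realType) (d : nat) : (d *+ 2)%:R = d%:R * 2 :> R.
Proof. by rewrite mulr_natr mulr2n mulr2n; exact: natrD. Qed.

Section SimpleRandomWalk.
Variables (R : realType) (d : nat).
Hypothesis d_gt0 : (0 < d)%N.

Let dR_gt0 : 0 < d%:R :> R. Proof. by rewrite ltr0n. Qed.


Definition bump_at (k : 'I_d -> nat) (i : 'I_d) : 'I_d -> nat :=
  fun j => (k j + (j == i))%N.

(* Average of [\prod_i srw1 (k i) (x i)] after [n] further uniform increments
   of the step counters [k]: a simple random walk first draws the coordinate
   in which it moves, and given these draws its coordinates are independent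
   one-dimensional walks. *)
Fixpoint prod_avg (n : nat) (k : 'I_d -> nat) (x : 'I_d -> int) : R :=
  if n is n'.+1 then d%:R^-1 * \sum_(i < d) prod_avg n' (bump_at k i) x
  else \prod_(i < d) srw1 R (k i) (x i).

Let shift (x : 'I_d -> int) (i : 'I_d) (s : int) : 'I_d -> int :=
  fun j => x j + (if j == i then s else 0).

(** Incrementing [k i] unfolds one step of [srw1] in coordinate [i], which averages over the shifts
    by 1 and -1. This turns the counter recursion into the one defining [srw_p]. *)
Lemma prod_avg_shift n k x :
  prod_avg n.+1 k x =
  (d *+ 2)%:R^-1 * \sum_(i < d) (prod_avg n k (shift x i 1) + prod_avg n k (shift x i (-1))).
Proof.
elim: n k x => [|n IH] k x.
  rewrite /= natr_double invfM -mulrA; congr (_ * _).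
  rewrite mulr_sumr; apply: eq_bigr => i _.
  rewrite !(bigD1 (P := predT) i)//=.
  rewrite {1}/bump_at eqxx addn1 /= {1 3}/shift eqxx.
  under eq_bigr => j ji do rewrite /bump_at (negbTE ji) addn0.
  under [in X in _ = _ * (X + _)]eq_bigr => j ji do rewrite /shift (negbTE ji) addr0.
  under [in X in _ = _ * (_ + X)]eq_bigr => j ji do rewrite /shift (negbTE ji) addr0.
  by rewrite -mulrDl; ring.
rewrite -[LHS]/(d%:R^-1 * \sum_(i < d) prod_avg n.+1 (bump_at k i) x).
under eq_bigr do rewrite IH.
rewrite -mulr_sumr exchange_big /= mulrCA; congr (_ * _).
by rewrite mulr_sumr; apply: eq_bigr => i _; rewrite -mulrDr big_split.
Qed.

Lemma srw_p_prod_avg n (x y : Zd d) :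
  srw_p R d n x y = prod_avg n (fun=> 0%N) (fun i => x i - y i).
Proof.
elim: n x => [|n IH] x.
  rewrite /=; case: eqP => [->|xy].
    by rewrite big1// => i _; rewrite subrr eqxx.
  have [i xyi] : exists i, x i != y i.
    apply/existsP; apply: contra_notT xy => /existsPn h.
    by apply/ffunP => i; apply/eqP; move: (h i); rewrite negbK.
  by rewrite (bigD1 i)//= subr_eq0 (negbTE xyi) mul0r.
rewrite prod_avg_shift /=; congr (_ * _); apply: eq_bigr => i _; rewrite !IH.
by congr (prod_avg _ _ _ + prod_avg _ _ _); apply/funext => j;
  rewrite /shift ffunE; case: eqP => _; rewrite ?addr0// addrAC.
Qed.

(* One step of negative association: a single counter incremented at a uniform
   index, against independent increments with probability [1 / d] each. *)
Lemma avg_prod_le (b b' : 'I_d -> R) :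
  (forall i, 0 < b i) -> (forall i, 0 <= b' i <= b i) ->
  d%:R^-1 * \sum_(i < d) \prod_(j < d) (if j == i then b' j else b j) <=
  \prod_(j < d) ((1 - d%:R^-1) * b j + d%:R^-1 * b' j).
Proof.
(* After division by the product of the [b j], the claim becomes [1 - \sum a <= \prod (1 - a)]. *)
move=> b0 b'b; pose a i := (1 - b' i / b i) / d%:R.
have r01 i : 0 <= b' i / b i <= 1.
  have /andP[h1 h2] := b'b i.
  by rewrite divr_ge0 ?(ltW (b0 i))//= ler_pdivrMr// mul1r.
have a01 i : 0 <= a i <= 1.
  have /andP[h1 h2] := r01 i.
  rewrite /a divr_ge0 ?subr_ge0 ?(ltW dR_gt0)//= ler_pdivrMr// mul1r.
  have : 1 <= d%:R :> R by rewrite ler1n.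
  by lra.
have /andP[W _] := @weierstrass_prod R _ (index_enum 'I_d) a a01.
have e1 : \prod_(j < d) ((1 - d%:R^-1) * b j + d%:R^-1 * b' j) =
    (\prod_(j < d) b j) * \prod_(j < d) (1 - a j).
  rewrite -big_split; apply: eq_bigr => j _ /=; rewrite /a.
  have := b0 j; have := dR_gt0 => *; field; lra.
rewrite e1; apply: le_trans (ler_wpM2l _ W); last first.
  by apply: prodr_ge0 => i _; apply: ltW.
have -> : \sum_(i < d) \prod_(j < d) (if j == i then b' j else b j) =
   (\prod_(j < d) b j) * \sum_(i < d) b' i / b i.
  rewrite mulr_sumr; apply: eq_bigr => i _.
  rewrite (bigD1 i)//= [in RHS](bigD1 i)//= eqxx.
  under eq_bigr => j ji do rewrite (negbTE ji).
  by have := b0 i => ?; field; lra.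
rewrite mulrCA; rewrite le_eqVlt; apply/orP; left; apply/eqP; congr (_ * _).
rewrite /a -mulr_suml big_split /= sumrN sumr_const card_ord.
have := dR_gt0 => *; field; lra.
Qed.

End SimpleRandomWalk.

Lemma bernoulli_ineq (R : realType) (u : R) n : 0 <= u <= 1 -> 1 - n%:R * u <= (1 - u) ^+ n.
Proof.
move=> u01; have /andP[+ _] := @weierstrass_prod R nat (iota 0 n) (fun=> u) (fun=> u01).
by rewrite !big_const_seq count_predT size_iota iter_addr_0 -Monoid.iteropE mulr_natl.
Qed.

(** Combines [(1 - u)(1 + u) <= 1] with [1 + n u <= (1 + u)^n]. *)
Lemma expr_le_inv (R : realType) (u : R) n : 0 <= u <= 1 -> (1 - u) ^+ n <= (1 + n%:R * u)^-1.
Proof.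
move=> /andP[u0 u1]; have nu0 : 0 <= n%:R * u by rewrite mulr_ge0.
rewrite -[leRHS]mul1r ler_pdivlMr; last by lra.
apply: le_trans (_ : (1 - u) ^+ n * (1 + u) ^+ n <= _).
  rewrite ler_wpM2l ?exprn_ge0 ?subr_ge0//.
  elim: n {nu0} => [|n IH]; first by rewrite mul0r addr0 expr0.
  rewrite exprS -natr1.
  have : 0 <= n%:R :> R by [].
  by move: IH; move: (_ ^+ n) n%:R => Y z IH z0; nra.
rewrite -exprMn exprn_ile1//; nra.
Qed.

(** * Transition probability bounds uniform in the dimension *)

Section HeatKernelBounds.
Variables (R : realType) (d : nat).
Hypothesis d_gt0 : (0 < d)%N.

Let dR_gt0 : 0 < d%:R :> R. Proof. by rewrite ltr0n. Qed.

Lemma srw_p_ge0 n (x y : Zd d) : 0 <= srw_p R d n x y.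
Proof.
elim: n x => [|n IH] x /=; first by case: ifP.
by rewrite mulr_ge0// sumr_ge0// => i _; rewrite addr_ge0.
Qed.

(* For the bound [f = lam + (1 - lam) rho ^ k] the binomial averages are explicit,
   and their product is a supersolution of the recursion defining [prod_avg]. *)
Lemma prod_avg_le (lam rho : R) n k x :
  0 < lam <= 1 -> 0 <= rho <= 1 ->
  (forall k j, srw1 R k j <= lam + (1 - lam) * rho ^+ k) ->
  prod_avg R d n k x <=
  \prod_(i < d) (lam + (1 - lam) * rho ^+ k i * (1 - (1 - rho) / d%:R) ^+ n).
Proof.
move=> /andP[l0 l1] /andP[r0 r1] H.
(* [s] is the mean of [rho ^ X] for a Bernoulli variable [X] of parameter [1 / d]. *)
set s := 1 - (1 - rho) / d%:R.
have d1 : 1 <= d%:R :> R by rewrite ler1n.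
have s0 : 0 <= s.
  rewrite /s subr_ge0 ler_pdivrMr ?mul1r//; lra.
elim: n k => [|n IH] k.
  apply: ler_prod => i _; rewrite srw1_ge0/= expr0 mulr1; exact: H.
pose b i := lam + (1 - lam) * rho ^+ k i * s ^+ n.
pose b' i := lam + (1 - lam) * rho ^+ (k i).+1 * s ^+ n.
apply: le_trans (_ : d%:R^-1 * \sum_(i < d) \prod_(j < d) (if j == i then b' j else b j) <= _).
  rewrite /= ler_wpM2l ?invr_ge0//; apply: ler_sum => i _.
  apply: le_trans (IH _) _.
  rewrite le_eqVlt; apply/orP; left; apply/eqP; apply: eq_bigr => j _.
  by rewrite /bump_at /b' /b; case: eqP => _; rewrite ?addn0 ?addn1.
have X0 i : 0 <= (1 - lam) * rho ^+ k i * s ^+ n.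
  by rewrite !mulr_ge0 ?exprn_ge0//; lra.
apply: le_trans (@avg_prod_le R d d_gt0 b b' _ _) _ => [i|i|].
- by rewrite /b; have := X0 i; lra.
- have := X0 i; rewrite /b /b' exprS.
  have -> : (1 - lam) * (rho * rho ^+ k i) * s ^+ n = rho * ((1 - lam) * rho ^+ k i * s ^+ n) by ring.
  move: (_ * s ^+ n) => X X0'; apply/andP; split; nra.
rewrite le_eqVlt; apply/orP; left; apply/eqP; apply: eq_bigr => j _.
rewrite /b /b' !exprS /s; field; lra.
Qed.

Lemma srw_p_le_mix (lam rho : R) n (x y : Zd d) :
  0 < lam <= 1 -> 0 <= rho <= 1 ->
  (forall k j, srw1 R k j <= lam + (1 - lam) * rho ^+ k) ->
  srw_p R d n x y <= (lam + (1 - lam) * (1 - (1 - rho) / d%:R) ^+ n) ^+ d.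
Proof.
move=> h1 h2 h3; rewrite srw_p_prod_avg//; apply: le_trans (@prod_avg_le lam rho n _ _ h1 h2 h3) _.
by rewrite prodr_const card_ord expr0 mulr1.
Qed.

Lemma srw_p_sup_mono (B : R) n m :
  (forall x y : Zd d, srw_p R d n x y <= B) -> (n <= m)%N ->
  forall x y : Zd d, srw_p R d m x y <= B.
Proof.
move=> H /subnK <-; elim: (m - n)%N => [//|l IH] x y.
rewrite addSn /= ler_pdivrMl; last first.
  by rewrite mulr2n natr_double mulr_gt0.
apply: le_trans (_ : \sum_(i < d) (B + B) <= _).
  by apply: ler_sum => i _; apply: lerD; apply: IH.
rewrite sumr_const card_ord -[leLHS]mulr_natl mulr2n natr_double//; lra.
Qed.

Lemma srw_p_exp_le n (x y : Zd d) : (n <= d)%N -> srw_p R d n x y <= expR (- (n%:R / 4)).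
Proof.
(* With [rho = 0] a coordinate that has moved costs a factor [1/2]; since [0 ^+ 0 = 1], an untouched
   one costs nothing. *)
move=> nd; apply: le_trans (@srw_p_le_mix (1 / 2) 0 n x y _ _ _) _.
- lra.
- by rewrite lexx ler01.
- move=> [|k] j; first by rewrite expr0; have := srw1_le1 R 0 j; lra.
  rewrite exprS mul0r; have := srw1_le_half R k j; lra.
have d1 : 1 <= d%:R :> R by rewrite ler1n.
have u01 : 0 <= (d%:R^-1 : R) <= 1 by rewrite invr_ge0 ltW//= invf_le1.
set s : R := n%:R / d%:R.
have s0 : 0 <= s by rewrite divr_ge0.
have s1 : s <= 1 by rewrite ler_pdivrMr// mul1r ler_nat.
have h : (1 - (1 - 0) / d%:R) ^+ n <= (1 + s)^-1 :> R.
  by rewrite subr0 mul1r; exact: expr_le_inv.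
have h2 : (1 + s)^-1 <= 1 - s / 2.
  rewrite -[leLHS]mul1r ler_pdivrMr; nra.
apply: le_trans (_ : (expR (- (s / 4))) ^+ d <= _).
  rewrite lerXn2r ?nnegrE ?expR_ge0//.
    rewrite addr_ge0//.
    rewrite subr0 !mul1r mulr_ge0 ?exprn_ge0//; case/andP: u01; lra.
  apply: le_trans (expR_ge1Dx _).
  by have := le_trans h h2; move: (_ ^+ n) => X hX; lra.
rewrite -expRM_natl; rewrite ler_expR.
rewrite le_eqVlt; apply/orP; left; apply/eqP; rewrite /s; field; lra.
Qed.

(** By time [q^6] a typical coordinate has made [q^6 / d >= 4 q^5] steps, well beyond the [q^4]
    steps after which [srw1] is at most [1/q]. The geometric part of the mixture is then also at
    most [1/q]. *)
Lemma srw_p_poly_le q n (x y : Zd d) : (4 <= q)%N -> (4 * d <= q)%N -> (q ^ 6 <= n)%N ->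
  srw_p R d n x y <= (2 / q%:R) ^+ d.
Proof.
move=> q4 dq qn.
have q4R : 4 <= q%:R :> R by rewrite (ler_nat R 4).
have dqR : 4 * d%:R <= q%:R :> R by rewrite -natrM ler_nat.
have qnR : q%:R ^+ 6 <= n%:R :> R by rewrite -natrX ler_nat.
have d1 : 1 <= d%:R :> R by rewrite ler1n.
have [Q QE] : exists Q : R, Q = q%:R by exists q%:R.
have [mu muE] : exists mu : R, mu = (4 * Q ^+ 4)^-1 by eexists.
rewrite -QE in q4R dqR qnR *.
have Q40 : 0 < 4 * Q ^+ 4 by rewrite mulr_gt0// exprn_gt0//; lra.
have Q41 : 1 <= 4 * Q ^+ 4.
  have : 1 <= Q ^+ 4 by rewrite exprn_ege1//; lra.
  lra.
have mu0 : 0 < mu by rewrite muE invr_gt0.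
have mu1 : mu <= 1 by rewrite muE invf_le1.
have Qi : Q^-1 <= 1 / 4.
  rewrite -[leLHS]mul1r ler_pdivrMr; lra.
have Qi0 : 0 < Q^-1 by rewrite invr_gt0; lra.
(* For [k >= q^4] the constant [1/q] dominates by [srw1_le4]. For smaller positive [k], Bernoulli's
   inequality keeps [(1 - mu)^k >= 3/4], above the bound [1/2] on [srw1]; this fixes [mu]. *)
have fit k j : srw1 R k j <= Q^-1 + (1 - Q^-1) * (1 - mu) ^+ k.
  have p0 : 0 <= (1 - mu) ^+ k by rewrite exprn_ge0; lra.
  case: (ltnP k (q ^ 4)) => kq; last first.
    apply: le_trans (_ : Q^-1 <= _); last by rewrite lerDl mulr_ge0//; lra.
    rewrite leNgt; apply/negP => lt1.
    have := srw1_le4 R k j; apply/negP; rewrite -ltNge.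
    have h4 : Q^-1 ^+ 4 < srw1 R k j ^+ 4 by rewrite ltrXn2r// ?nnegrE ?srw1_ge0// ltW.
    have kqR : Q ^+ 4 <= k%:R :> R by rewrite QE -natrX ler_nat.
    have e : Q^-1 ^+ 4 * Q ^+ 4 = 1 by rewrite -exprMn mulVf ?expr1n//; lra.
    have : 0 < Q ^+ 4 by rewrite exprn_gt0//; lra.
    have : 0 <= Q^-1 ^+ 4 by rewrite exprn_ge0 ?ltW.
    move: h4 kqR e; move: (Q^-1 ^+ 4) (Q ^+ 4) (srw1 R k j ^+ 4) (k%:R) => A B W K AW BK AB A0 B0.
    have h1 : A * B < W * B by rewrite ltr_pM2r.
    have h2 : W * B <= W * K by rewrite ler_wpM2l//; lra.
    nra.
  case: k p0 kq => [|k] p0 kq.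
    by rewrite expr0; have := srw1_le1 R 0 j; lra.
  have B : 1 - k.+1%:R * mu <= (1 - mu) ^+ k.+1 by apply: bernoulli_ineq; lra.
  have kmu : k.+1%:R * mu <= 1 / 4.
    rewrite muE ler_pdivrMr//.
    have : k.+1%:R <= Q ^+ 4 :> R by rewrite QE -natrX ler_nat ltnW.
    lra.
  have := srw1_le_half R k j; nra.
apply: le_trans (@srw_p_le_mix (Q^-1) (1 - mu) n x y _ _ _) _ => //; [lra|lra|].
have u01 : 0 <= mu / d%:R <= 1.
  by rewrite divr_ge0 ?(ltW mu0)//= ler_pdivrMr// mul1r; lra.
have h : (1 - mu / d%:R) ^+ n <= Q^-1.
  apply: le_trans (expr_le_inv _ _ _ u01) _.
  rewrite lef_pV2 ?posrE; last 2 first.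
  - by rewrite ltr_wpDr// mulr_ge0//; case/andP: u01.
  - by lra.
  apply: le_trans (_ : n%:R * (mu / d%:R) <= _); last lra.
  rewrite muE -invfM ler_pdivlMr; last by rewrite mulr_gt0.
  apply: le_trans qnR.
  have -> : Q * (4 * Q ^+ 4 * d%:R) = Q ^+ 5 * (4 * d%:R) by ring.
  by rewrite [leRHS]exprSr ler_wpM2l// exprn_ge0//; lra.
rewrite lerXn2r ?nnegrE//.
- rewrite addr_ge0 ?(ltW Qi0)// mulr_ge0//; first lra.
  by rewrite exprn_ge0//; case/andP: u01; lra.
- by rewrite divr_ge0//; lra.
rewrite subKr; have : 0 <= (1 - mu / d%:R) ^+ n.
  by rewrite exprn_ge0//; case/andP: u01; lra.
move: h; move: (_ ^+ n) (Q^-1) Qi0 => X Y Y0 XY X0; nra.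
Qed.

End HeatKernelBounds.

Lemma pow_le_expR (R : realType) (C : R) k :
  exists x0 : nat, forall x : R, x0%:R <= x -> C * x ^+ k <= expR x.
Proof.
exists (Num.truncn (`|C| * k.+1`!%:R)).+1 => x hx.
have x0 : 0 < x by apply: lt_le_trans hx.
have hC : `|C| * k.+1`!%:R <= x.
  by apply: le_trans hx; apply: ltW; exact: truncnS_gt.
have f0 : 0 < k.+1`!%:R :> R by rewrite ltr0n fact_gt0.
apply: le_trans (_ : 1 + x ^+ k.+1 / k.+1`!%:R <= _); last exact: expR_ge1Dxn (ltW x0).
apply: le_trans (_ : x ^+ k.+1 / k.+1`!%:R <= _); last by rewrite lerDr.
rewrite exprS ler_pdivlMr// mulrAC ler_wpM2r ?exprn_ge0 ?(ltW x0)//.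
by apply: le_trans hC; rewrite ler_wpM2r ?ler_norm// (ltW f0).
Qed.

Lemma nat_pow_bracket (k n : nat) : (0 < k)%N -> exists q, (q ^ k <= n < q.+1 ^ k)%N.
Proof.
move=> k0; elim: n => [|n [q /andP[h1 h2]]].
  by exists 0%N; rewrite exp0n// exp1n.
case: (ltnP n.+1 (q.+1 ^ k)) => h; first by exists q; rewrite h andbT ltnW.
exists q.+1; rewrite h; apply: leq_trans (_ : n.+2 <= (q.+1 ^ k).+1)%N _ => //.
by rewrite ltn_exp2r.
Qed.

(** Three regimes. For [n <= d] the bound [exp(-n/4)] suffices. For [d < n < (4d)^6] monotonicity
    from time [d] gives [exp(-d/4)], which beats [n^3 < (4d)^18]. Beyond that, [q] is the integer
    sixth root of [n]. *)
Lemma srw_p_cube (R : realType) : exists n0 : nat, forall d n (x y : Zd d),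
  (n0 <= d)%N -> (n0 <= n)%N -> srw_p R d n x y <= (n%:R ^+ 3)^-1.
Proof.
have [x1 H1] := @pow_le_expR R (4 ^+ 3) 3.
have [x2 H2] := @pow_le_expR R (16 ^+ 18) 18.
exists (maxn 40 (maxn (4 * x1) (4 * x2))) => d n x y.
rewrite !geq_max => /and3P[d40 _ d2] /and3P[n40 n1 _].
have d0 : (0 < d)%N by apply: leq_trans d40.
have n0 : 0 < n%:R :> R by rewrite ltr0n; apply: leq_trans n40.
have n30 : 0 < n%:R ^+ 3 :> R by rewrite exprn_gt0.
case: (leqP n d) => nd.
  apply: le_trans (srw_p_exp_le _ _ d0 _ _ _ nd) _.
  rewrite expRN lef_pV2 ?posrE ?expR_gt0//.
  apply: le_trans (H1 (n%:R / 4) _); last first.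
    by rewrite ler_pdivlMr// mulrC -natrM ler_nat.
  by rewrite -exprMn mulrC divfK.
case: (ltnP n ((4 * d) ^ 6)) => nq.
  apply: le_trans (_ : expR (- (d%:R / 4)) <= _).
    by apply: (srw_p_sup_mono _ _ d0 _ _ _ _ (ltnW nd)) => x' y'; exact: srw_p_exp_le.
  rewrite expRN lef_pV2 ?posrE ?expR_gt0//.
  apply: le_trans (H2 (d%:R / 4) _); last first.
    by rewrite ler_pdivlMr// mulrC -natrM ler_nat.
  rewrite -exprMn (_ : 16 * (d%:R / 4) = 4 * d%:R :> R); last by field.
  rewrite (exprM _ 6 3) lerXn2r ?nnegrE ?(ltW n0) ?exprn_ge0 ?mulr_ge0//.
  by rewrite -natrM -natrX ler_nat ltnW.
have [q /andP[q1 q2]] := @nat_pow_bracket 6 n isT.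
have dq : (4 * d <= q)%N by rewrite -ltnS -(@ltn_exp2r _ _ 6)//; apply: leq_ltn_trans q2.
have q8 : (8 <= q)%N by lia.
have q8R : 8 <= q%:R :> R by rewrite (ler_nat R 8).
apply: le_trans (srw_p_poly_le _ _ d0 _ _ _ _ _ dq q1) _; first by lia.
have nQ : n%:R ^+ 3 <= (2 * q%:R) ^+ 18 :> R.
  rewrite (exprM _ 6 3) lerXn2r ?nnegrE ?(ltW n0) ?exprn_ge0 ?mulr_ge0//.
  rewrite -natrM -natrX ler_nat; apply: leq_trans (ltnW q2) _.
  by rewrite leq_exp2r//; lia.
apply: le_trans (_ : (2 / q%:R) ^+ 40 <= _).
  rewrite ler_wiXn2l ?divr_ge0//.
  by rewrite ler_pdivrMr; lra.
rewrite -[leRHS]mul1r ler_pdivlMr//.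
apply: le_trans (ler_wpM2l _ nQ) _; first by rewrite exprn_ge0 ?divr_ge0.
set Q : R := q%:R.
(* Here [(2/q)^40 (2q)^18 = (8/q)^18 (2/q)^4], and [q >= 8]. *)
rewrite (_ : 40 = 2 * 18 + 4)%N// exprD exprM mulrAC -exprMn.
rewrite (_ : (2 / Q) ^+ 2 * (2 * Q) = 8 / Q); last by field; rewrite /Q; lra.
have h c : 0 <= c <= 8 -> 0 <= c / Q <= 1.
  by move=> /andP[c0 c8]; rewrite divr_ge0//= ler_pdivrMr /Q; lra.
have /andP[a0 a1] := h 8 ltac:(lra); have /andP[b0 b1] := h 2 ltac:(lra).
by rewrite mulr_ile1 ?exprn_ge0 ?exprn_ile1.
Qed.

(** * The l1 distance and the first steps of the walk *)

Definition l1 {d : nat} (x y : Zd d) : nat := (\sum_(i < d) absz (x i - y i))%N.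

Section L1.
Context {d : nat}.
Implicit Types x y z : Zd d.

Lemma l1xx x : l1 x x = 0%N.
Proof. by rewrite /l1 big1// => i _; rewrite subrr. Qed.

Lemma l1C x y : l1 x y = l1 y x.
Proof. by apply: eq_bigr => i _; rewrite distnC. Qed.

Lemma l1_triangle y x z : (l1 x z <= l1 x y + l1 y z)%N.
Proof. by rewrite -big_split; apply: leq_sum => i _ /=; lia. Qed.

Lemma l1_eq0 x y : (l1 x y == 0%N) = (x == y).
Proof.
apply/idP/eqP => [|->]; last by rewrite l1xx.
rewrite sum_nat_eq0 => /forallP h; apply/ffunP => i.
by have := h i; rewrite /= => /eqP; lia.
Qed.

Lemma l1_zshift x i (s : int) y :
  (l1 (zshift x i s) y + absz (x i - y i) = l1 x y + absz ((x i + s)%R - y i))%N.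
Proof.
rewrite /l1 (bigD1 i)//= [in RHS](bigD1 i)//= ffunE eqxx.
under eq_bigr => j ji do rewrite ffunE (negbTE ji) addr0.
by lia.
Qed.

Definition nbr_at (r : nat) x y : nat :=
  (\sum_(i < d) ((l1 (zshift x i 1) y == r) + (l1 (zshift x i (-1)) y == r)))%N.

Lemma nbr_at_le r x y : (nbr_at r x y <= d * 2)%N.
Proof.
apply: leq_trans (_ : \sum_(i < d) 2 <= _)%N; last by rewrite sum_nat_const card_ord.
by apply: leq_sum => i _; do 2 case: eqP.
Qed.

(** A step towards [y] must use a coordinate where [x] and [y] differ, with a single possible sign,
    and there are at most [l1 x y] such coordinates. *)
Lemma nbr_at_lower r x y : l1 x y = r.+1 -> (nbr_at r x y <= r.+1)%N.
Proof.
move=> xy; rewrite -xy [leqRHS]/l1; apply: leq_sum => i _.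
by have := l1_zshift x i 1 y; have := l1_zshift x i (-1) y;
  do 2 case: eqP => //=; lia.
Qed.

Lemma nbr_at_eq0 r x y : l1 x y != r.+1 -> (l1 x y).+1 != r -> nbr_at r x y = 0%N.
Proof.
move=> h1 h2; apply: big1 => i _.
by have := l1_zshift x i 1 y; have := l1_zshift x i (-1) y;
  do 2 case: eqP => //=; lia.
Qed.

End L1.

Section SmallTimes.
Variables (R : realType) (d : nat).
Hypothesis d_gt0 : (0 < d)%N.
Implicit Types x y : Zd d.

Let dR_gt0 : 0 < d%:R :> R. Proof. by rewrite ltr0n. Qed.

(** Propagates bounds of the form constant plus multiple of a sphere indicator; few neighbours lying
    on that sphere means a gain of order [1/d]. *)
Lemma srw_p_step_le n (a c : R) r x y :
  (forall z, srw_p R d n z y <= a + c * (l1 z y == r)%:R) ->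
  srw_p R d n.+1 x y <= a + c * (nbr_at r x y)%:R / (d%:R * 2).
Proof.
move=> H; rewrite /= natr_double.
have D0 : 0 < d%:R * 2 :> R by rewrite mulr_gt0.
rewrite ler_pdivrMl// mulrDr mulrCA mulfV ?gt_eqF// mulr1.
rewrite natr_sum mulr_sumr.
have -> : d%:R * 2 * a = \sum_(i < d) (a + a).
  by rewrite sumr_const card_ord -mulr_natl; ring.
rewrite -big_split; apply: ler_sum => i _ /=.
have := H (zshift x i 1); have := H (zshift x i (-1)); rewrite natrD; lra.
Qed.

Lemma srw_p1_le x y : srw_p R d 1 x y <= (d%:R * 2)^-1 * (l1 x y == 1)%:R.
Proof.
apply: le_trans (@srw_p_step_le 0 0 1 0 x y _) _.
  by move=> z; rewrite /= l1_eq0 add0r mul1r; case: eqP.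
rewrite add0r mul1r mulrC ler_wpM2l ?invr_ge0 ?mulr_ge0//.
case: eqP => h; first by rewrite (le_trans _ (_ : 1%:R <= _))// ler_nat nbr_at_lower.
by rewrite nbr_at_eq0//; apply/eqP.
Qed.

Lemma srw_p2_le x y :
  srw_p R d 2 x y <= (d%:R ^+ 2 * 2)^-1 + (d%:R * 2)^-1 * (l1 x y == 0)%:R.
Proof.
apply: le_trans (@srw_p_step_le 1 0 (d%:R * 2)^-1 1 x y _) _.
  by move=> z; rewrite add0r srw_p1_le.
rewrite add0r.
have [u uE] : exists u : R, u = (d%:R * 2)^-1 by eexists.
have u0 : 0 < u by rewrite uE invr_gt0 mulr_gt0.
have ud : u * (d * 2)%:R = 1 by rewrite uE natrM mulVf// gt_eqF// mulr_gt0.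
have -> : (d%:R ^+ 2 * 2)^-1 = u * u * 2 by rewrite uE; field; rewrite gt_eqF.
rewrite -uE.
have [xy0|xy0] := eqVneq (l1 x y) 0%N.
  have : (nbr_at 1 x y)%:R <= (d * 2)%:R :> R by rewrite ler_nat nbr_at_le.
  rewrite mulr1; move: (nbr_at _ _ _)%:R => N hN.
  have : u * N <= 1 by rewrite -ud ler_pM2l.
  have : 0 < u * u by rewrite mulr_gt0.
  nra.
rewrite mulr0 addr0 mulrAC ler_wpM2l ?mulr_ge0 ?(ltW u0)// (ler_nat R _ 2).
have [xy2|xy2] := eqVneq (l1 x y) 2%N; first exact: nbr_at_lower.
by rewrite nbr_at_eq0// eqSS.
Qed.

Lemma srw_p3_le x y : srw_p R d 3 x y <= (d%:R ^+ 2)^-1.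
Proof.
have [u uE] : exists u : R, u = (d%:R * 2)^-1 by eexists.
have u0 : 0 < u by rewrite uE invr_gt0 mulr_gt0.
have h z : srw_p R d 2 z y <= u * u * 2 + u * (l1 z y == 0)%:R.
  apply: le_trans (srw_p2_le z y) _; rewrite uE lerD2r le_eqVlt; apply/orP; left.
  by apply/eqP; field; rewrite gt_eqF.
apply: le_trans (srw_p_step_le _ _ _ _ x y h) _.
have -> : (d%:R ^+ 2)^-1 = u * u * 4 by rewrite uE; field; rewrite gt_eqF.
have : (nbr_at 0 x y)%:R <= 1 :> R.
  rewrite (ler_nat R _ 1); have [xy1|xy1] := eqVneq (l1 x y) 1%N; first exact: nbr_at_lower.
  by rewrite nbr_at_eq0.
rewrite -uE; move: (nbr_at _ _ _)%:R => N hN.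
have : 0 < u * u by rewrite mulr_gt0.
nra.
Qed.

Lemma srw_p_out n x y : (n < l1 x y)%N -> srw_p R d n x y = 0.
Proof.
elim: n x => [|n IH] x xy /=.
  by move: xy; rewrite lt0n l1_eq0 => /negbTE ->.
rewrite big1 ?mulr0// => i _; rewrite !IH ?addr0//.
- by have := l1_zshift x i (-1) y; lia.
- by have := l1_zshift x i 1 y; lia.
Qed.

(** From time 3 on, [srw_p_sup_mono] preserves the bound [d^-2], so that the first [d] times sum to
    order [1/d] apart from the term [n = 0]. *)
Lemma srw_p_le_small n x y :
  srw_p R d n x y <= (n == 0)%:R * (x == y)%:R +
    ((n == 1)%:R + (n == 2)%:R) * (d%:R * 2)^-1 + (d%:R ^+ 2)^-1.
Proof.
have c0 : 0 < (d%:R ^+ 2)^-1 :> R by rewrite invr_gt0 exprn_gt0.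
have c1 : 0 < (d%:R * 2)^-1 :> R by rewrite invr_gt0 mulr_gt0.
have p1 x' y' : srw_p R d 1 x' y' <= (d%:R * 2)^-1.
  apply: le_trans (srw_p1_le _ _) _; case: eqP => _; rewrite ?mulr1 ?mulr0//; exact: ltW.
case: n => [|[|[|n]]].
- by rewrite /=; case: eqP => _; rewrite ?mulr1n ?mulr0n; lra.
- by have := p1 x y; move: (srw_p R d 1 x y) => Z /=; rewrite ?mulr1n ?mulr0n; lra.
- have := srw_p_sup_mono _ _ d_gt0 _ _ 2%N p1 isT x y.
  by move: (srw_p R d 2 x y) => Z /=; rewrite ?mulr1n ?mulr0n; lra.
- have := srw_p_sup_mono _ _ d_gt0 _ _ n.+3 srw_p3_le isT x y.
  by rewrite !mul0r addr0 mul0r !add0r.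
Qed.

End SmallTimes.

(** * Bounds on the Green function *)

Section GreenBounds.
Variable R : realType.

(** Finiteness matters because [fine] sends an infinite series to 0. *)
Lemma green_fin {d : nat} (x y : Zd d) (B : R) :
  (forall M, \sum_(0 <= n < M) srw_p R d n x y <= B) ->
  [/\ green R d x y \is a fin_num, (0 <= green R d x y)%E & (green R d x y <= B%:E)%E].
Proof.
move=> H.
have p0 n : (0 <= (srw_p R d n x y)%:E)%E by rewrite lee_fin srw_p_ge0.
have g0 : (0 <= green R d x y)%E by apply: nneseries_ge0 => n _ _.
have gB : (green R d x y <= B%:E)%E.
  apply: lime_le; first by apply: is_cvg_nneseries => n _ _.
  by apply: nearW => M; rewrite sumEFin lee_fin.
by split=> //; rewrite ge0_fin_numE//; apply: le_lt_trans gB _; exact: ltry.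
Qed.

Lemma green_le {d : nat} (x y : Zd d) (B : R) :
  (forall M, \sum_(0 <= n < M) srw_p R d n x y <= B) -> 0 <= fine (green R d x y) <= B.
Proof. by move=> /green_fin[gf g0 gB]; rewrite -!lee_fin fineK// g0 gB. Qed.

Lemma green_diag_ge1 {d : nat} (x : Zd d) (B : R) :
  (forall M, \sum_(0 <= n < M) srw_p R d n x x <= B) -> 1 <= fine (green R d x x).
Proof.
move=> /green_fin[gf _ _]; rewrite -lee_fin fineK//.
apply: le_trans (nneseries_lim_ge 1%N _) => [|n _ _]; last by rewrite lee_fin srw_p_ge0.
by rewrite big_nat1 /= eqxx.
Qed.

Lemma inv_cube_le_telescope (n : nat) : (2 <= n)%N ->
  (n%:R ^+ 3)^-1 <= (n%:R ^+ 2)^-1 - (n.+1%:R ^+ 2)^-1 :> R.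
Proof.
move=> n2; rewrite -natr1; have : 2 <= n%:R :> R by rewrite (ler_nat R 2).
move: n%:R => t t2.
have -> : (t ^+ 2)^-1 - ((t + 1) ^+ 2)^-1 = (2 * t + 1) / (t ^+ 2 * (t + 1) ^+ 2).
  by field; apply/andP; split; lra.
have -> : (t ^+ 3)^-1 = ((t + 1) ^+ 2 / t) / (t ^+ 2 * (t + 1) ^+ 2).
  by field; apply/andP; split; lra.
rewrite ler_wpM2r ?invr_ge0 ?mulr_ge0 ?exprn_ge0//; try lra.
by rewrite ler_pdivrMr; nra.
Qed.

(** Before time [d], times 1 and 2 give [1/(2d)] each and the [d^-2] terms at most [1/d]; afterwards
    the cube bound telescopes to [d^-2 <= 1/d]. At distance at least [r] the first [r] terms vanish,
    and the same telescoping leaves [r^-2]. *)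
Lemma green_sums_le : exists n0 : nat, forall d, (n0 <= d)%N ->
  (forall (x y : Zd d) M, \sum_(0 <= n < M) srw_p R d n x y <= (x == y)%:R + 3 / d%:R) /\
  (forall (x y : Zd d) r M, (n0 <= r)%N -> (r <= l1 x y)%N ->
    \sum_(0 <= n < M) srw_p R d n x y <= (r%:R ^+ 2)^-1).
Proof.
have [n0 H] := srw_p_cube R; exists (maxn 2 n0) => d.
rewrite geq_max => /andP[d2 dn0].
have d0 : (0 < d)%N by lia.
have dR : 2 <= d%:R :> R by rewrite (ler_nat R 2).
have cube n (x y : Zd d) : (2 <= n)%N -> (n0 <= n)%N ->
    srw_p R d n x y <= (n%:R ^+ 2)^-1 - (n.+1%:R ^+ 2)^-1.
  by move=> n2 nn0; apply: le_trans (H _ _ _ _ dn0 nn0) _; exact: inv_cube_le_telescope.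
split=> x y.
  have small M : \sum_(0 <= n < M) srw_p R d n x y <= (0 < M)%N%:R * (x == y)%:R +
      ((1 < M)%N%:R + (2 < M)%N%:R) * (d%:R * 2)^-1 + M%:R * (d%:R ^+ 2)^-1.
    elim: M => [|M IH]; first by rewrite big_nil /= !mulr0n addr0 !mul0r !addr0.
    rewrite big_nat_recr//=; apply: le_trans (lerD IH (srw_p_le_small _ _ d0 _ _ _)) _.
    rewrite -natr1; move: (x == y)%:R (d%:R * 2)^-1 (d%:R ^+ 2)^-1 => a b c.
    by case: M {IH} => [|[|[|M]]] /=; rewrite ?mulr1n ?mulr0n; lra.
  have e1 (b : bool) : b%:R <= 1 :> R by case: b.
  have xy0 : 0 <= (x == y)%:R :> R by [].
  have fin M : (M <= d)%N -> \sum_(0 <= n < M) srw_p R d n x y <= (x == y)%:R + 2 / d%:R.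
    move=> Md; apply: le_trans (small M) _.
    have MdR : M%:R <= d%:R :> R by rewrite ler_nat.
    have -> : 2 / d%:R = (1 + 1) * (d%:R * 2)^-1 + d%:R * (d%:R ^+ 2)^-1 :> R by field; lra.
    rewrite addrA lerD//; last by rewrite ler_wpM2r// invr_ge0 exprn_ge0.
    rewrite lerD//; last by rewrite ler_wpM2r ?lerD// invr_ge0 mulr_ge0.
    by rewrite -[leRHS]mul1r ler_wpM2r.
  have D : 2 / d%:R + (d%:R ^+ 2)^-1 <= 3 / d%:R :> R.
    have -> : (d%:R ^+ 2)^-1 = (1 / d%:R) / d%:R :> R by field; lra.
    rewrite -mulrDl ler_wpM2r ?invr_ge0//.
    have : 1 / d%:R <= 1 :> R by rewrite ler_pdivrMr; lra.
    lra.
  move=> M; case: (leqP M d) => [Md|/ltnW dM].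
    apply: le_trans (fin M Md) _; rewrite lerD2l.
    by rewrite ler_wpM2r ?invr_ge0// ler_nat.
  apply: le_trans (_ : (x == y)%:R + 2 / d%:R + ((d%:R ^+ 2)^-1 - (M%:R ^+ 2)^-1) <= _); last first.
    have : 0 <= (M%:R ^+ 2)^-1 :> R by rewrite invr_ge0 exprn_ge0.
    lra.
  rewrite -(subnKC dM); elim: (M - d)%N => [|k IH].
    by rewrite addn0 subrr addr0 fin.
  rewrite addnS big_nat_recr//=.
  apply: le_trans (lerD IH (cube (d + k)%N x y _ _)) _; [lia|lia|].
  by rewrite -addrA subrKA.
move=> r M; rewrite geq_max => /andP[r2 rn0] rxy.
have zero K : (K <= r)%N -> \sum_(0 <= n < K) srw_p R d n x y = 0.
  move=> Kr; rewrite big_nat big1// => n /andP[_ nK]; apply: srw_p_out; lia.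
case: (leqP M r) => [Mr|/ltnW rM]; first by rewrite zero// invr_ge0 exprn_ge0.
apply: le_trans (_ : (r%:R ^+ 2)^-1 - (M%:R ^+ 2)^-1 <= _); last first.
  by rewrite gerBl invr_ge0 exprn_ge0.
rewrite -(subnKC rM); elim: (M - r)%N => [|k IH].
  by rewrite addn0 subrr zero.
rewrite addnS big_nat_recr//=.
apply: le_trans (lerD IH (cube (r + k)%N x y _ _)) _; [lia|lia|].
by rewrite subrKA.
Qed.

End GreenBounds.

(** * Trees of paths *)

Section Lattice.
Context {d : nat}.
Implicit Types x y z : Zd d.

Definition box (L : nat) : seq (Zd d) :=
  map (fun f : {ffun 'I_d -> 'I_(2 * L).+1} => [ffun i => (f i : nat)%:Z - L%:Z])
    (enum {ffun 'I_d -> 'I_(2 * L).+1}).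

Lemma size_box L : size (box L) = ((2 * L).+1 ^ d)%N.
Proof. by rewrite size_map -cardE card_ffun !card_ord. Qed.

Lemma mem_box L x : (forall i, absz (x i) <= L)%N -> x \in box L.
Proof.
move=> H; apply/mapP.
have P i : (absz (x i + L%:Z)%R < (2 * L).+1)%N by have := H i; lia.
exists [ffun i => Ordinal (P i)]; first by rewrite mem_enum.
by apply/ffunP => i; rewrite !ffunE /=; have := H i; lia.
Qed.

Definition sphere x (r : nat) : seq (Zd d) :=
  [seq y <- map (fun u : Zd d => [ffun i => x i + u i] : Zd d) (box r) | l1 x y == r].

Lemma mem_sphere x y r : l1 x y = r -> y \in sphere x r.
Proof.
move=> xyr; rewrite mem_filter xyr eqxx/=; apply/mapP.
exists [ffun i => y i - x i]; last by apply/ffunP => i; rewrite !ffunE addrC subrK.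
apply: mem_box => i; rewrite ffunE -xyr /l1 (bigD1 i)//=; lia.
Qed.

Lemma sphere_l1 x y r : y \in sphere x r -> l1 x y = r.
Proof. by rewrite mem_filter => /andP[/eqP]. Qed.

Lemma geometric_abs_sum (R : realType) (z : R) r : 0 <= z <= 1 ->
  (1 - z) * (\sum_(j < (2 * r).+1) z ^+ absz (j%:Z - r%:Z)) <= 2 - 2 * z ^+ r.+1.
Proof.
move=> /andP[z0 z1]; elim: r => [|r IH].
  by rewrite big_ord1 /= expr0 expr1; lra.
rewrite (_ : (2 * r.+1).+1 = (2 * r).+3)%N; last lia.
rewrite big_ord_recl big_ord_recr /=.
under eq_bigr => i _.
  rewrite (_ : absz (_ - _) = absz (i%:Z - r%:Z)); last by rewrite /bump /=; lia.
  over.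
rewrite /= subn0 (_ : absz ((bump 0 (2 * r).+1)%:Z - _) = r.+1); last by rewrite /bump /=; lia.
rewrite (exprS z r.+1); move: IH; move: (\sum_(_ < _) _) (z ^+ r.+1) => S Z; lra.
Qed.

(* A Chernoff bound: a point at distance [r] has weight at least [z ^+ r],
   with [z = m / m.+1], and the weights factorize over the coordinates. *)
Lemma size_sphere_le (R : realType) x r m : (0 < m)%N -> (r <= m * d)%N ->
  (size (sphere x r))%:R <= (expR 1 * (2 * m.+1%:R)) ^+ d :> R.
Proof.
move=> m0 rmd.
have mR : 0 < m%:R :> R by rewrite ltr0n.
pose z : R := m%:R / m.+1%:R.
have z0 : 0 < z by rewrite divr_gt0.
have z1 : z <= 1 by rewrite ler_pdivrMr// mul1r ler_nat.
have step : (size (sphere x r))%:R * z ^+ r <=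
    \sum_(f : {ffun 'I_d -> 'I_(2 * r).+1}) \prod_(i < d) z ^+ absz ((f i : nat)%:Z - r%:Z).
  rewrite size_filter 2!count_map.
  have gen (s : seq {ffun 'I_d -> 'I_(2 * r).+1}) (a : pred {ffun 'I_d -> 'I_(2 * r).+1}) :
      (forall f, a f -> (\sum_(i < d) absz ((f i : nat)%:Z - r%:Z) = r)%N) ->
      (count a s)%:R * z ^+ r <= \sum_(f <- s) \prod_(i < d) z ^+ absz ((f i : nat)%:Z - r%:Z).
    move=> ar; elim: s => [|f s IH]; first by rewrite big_nil mul0r.
    rewrite big_cons /= natrD mulrDl lerD// prodrXr.
    case: (boolP (a f)) => [/ar ->|_]; first by rewrite mulr1n mul1r.
    by rewrite mulr0n mul0r exprn_ge0// ltW.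
  apply: le_trans (gen _ _ _) _; last by rewrite big_enum.
  by move=> f /eqP /= fr; rewrite -[RHS]fr; apply: eq_bigr => i _; rewrite !ffunE; lia.
have fact : \sum_(f : {ffun 'I_d -> 'I_(2 * r).+1}) \prod_(i < d) z ^+ absz ((f i : nat)%:Z - r%:Z)
    <= (2 * m.+1%:R) ^+ d.
  rewrite -(bigA_distr_bigA (fun (_ : 'I_d) (j : 'I_(2 * r).+1) => z ^+ absz ((j : nat)%:Z - r%:Z)))/=.
  rewrite prodr_const card_ord lerXn2r ?nnegrE ?mulr_ge0//.
    by apply: sumr_ge0 => j _; rewrite exprn_ge0 ?ltW.
  have z01 : 0 <= z <= 1 by rewrite (ltW z0).
  have := geometric_abs_sum R z r z01.
  have -> : 1 - z = m.+1%:R^-1 by rewrite /z -natr1; field; lra.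
  rewrite ler_pdivrMl// mulrC => /le_trans; apply.
  by rewrite ler_wpM2r//; have := exprn_ge0 r.+1 (ltW z0); lra.
(* As [z^-1 = 1 + 1/m <= exp(1/m)] and [r <= m d], dividing by [z^r] costs at most [e^d]. *)
have zi : 1 <= z ^+ r * expR 1 ^+ d.
  have zE : z^-1 <= expR (m%:R^-1).
    apply: le_trans (expR_ge1Dx _).
    by rewrite /z invf_div -natr1 mulrDl divff ?mul1r// gt_eqF.
  apply: le_trans (_ : z ^+ r * z^-1 ^+ r <= _).
    by rewrite -exprMn mulfV ?expr1n// gt_eqF.
  rewrite ler_wpM2l ?exprn_ge0 ?(ltW z0)//.
  apply: le_trans (_ : expR (m%:R^-1) ^+ r <= _).
    by rewrite lerXn2r ?nnegrE ?invr_ge0 ?expR_ge0 ?(ltW z0).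
  rewrite -!expRM_natl ler_expR mulr1 ler_pdivrMr// -natrM ler_nat mulnC//.
rewrite exprMn; apply: le_trans (_ : (size (sphere x r))%:R * (z ^+ r * expR 1 ^+ d) <= _).
  by rewrite ler_peMr.
rewrite mulrA mulrC ler_wpM2l ?exprn_ge0 ?expR_ge0//.
exact: le_trans step fact.
Qed.

Definition nbrs x : seq (Zd d) :=
  flatten [seq [:: zshift x i 1; zshift x i (-1)] | i <- enum 'I_d].

Lemma size_nbrs x : size (nbrs x) = (d * 2)%N.
Proof.
rewrite /nbrs -[in RHS](size_enum_ord d).
by elim: (enum 'I_d) => [//|i s /= ->]; rewrite mulSn.
Qed.

Lemma mem_nbrs x y : nnb x y -> y \in nbrs x.
Proof.
move=> /eqP xy; have [i xyi] : exists i, x i != y i.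
  apply/existsP; apply: contra_eqT xy => /existsPn h.
  by rewrite big1// => i _; have := h i; rewrite negbK => /eqP ->; rewrite subrr.
move: xy; rewrite (bigD1 i)//=.
set S := (\sum_(_ < _ | _) _)%N => xy.
have [S0 xy1] : S = 0%N /\ absz (x i - y i) = 1%N.
  by move: xyi xy => /eqP; move: S (x i) (y i) => S a b ab; lia.
have others j : j != i -> y j = x j.
  by move=> ji; move/eqP: S0; rewrite sum_nat_eq0 => /forallP /(_ j); rewrite ji /= => /eqP; lia.
apply/flatten_mapP; exists i; first by rewrite mem_enum.
rewrite !inE; apply/orP.
have [e|e] : y i = x i + 1 \/ y i = x i - 1 by lia.
- left; apply/eqP/ffunP => j; rewrite ffunE; case: eqP => [->//|/eqP ji].
  by rewrite addr0 others.
- right; apply/eqP/ffunP => j; rewrite ffunE; case: eqP => [->//|/eqP ji].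
  by rewrite addr0 others.
Qed.

Fixpoint walks (n : nat) x : seq (seq (Zd d)) :=
  if n is n'.+1 then [seq x :: s | s <- flatten [seq walks n' y | y <- nbrs x]]
  else [:: [:: x]].

Lemma size_walks n x : size (walks n x) = ((d * 2) ^ n)%N.
Proof.
elim: n x => [//|n IH] x /=.
rewrite size_map size_flatten /shape -map_comp.
rewrite (eq_map (g := fun=> (d * 2) ^ n)%N) => [|y]; last exact: IH.
rewrite expnS; move: (_ ^ n)%N => c; rewrite -(size_nbrs x); elim: (nbrs x) => [//|a s IHs].
by rewrite /= IHs mulSn.
Qed.

Lemma mem_walks x p : path nnb x p -> x :: p \in walks (size p) x.
Proof.
elim: p x => [|y p IH] x /=; first by rewrite inE.
move=> /andP[xy yp]; apply/map_f/flatten_mapP; exists y; [exact: mem_nbrs|exact: IH].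
Qed.

Lemma walks_size n x s : s \in walks n x -> size s = n.+1.
Proof.
elim: n x s => [|n IH] x s /=; first by rewrite inE => /eqP ->.
by move=> /mapP[s' /flatten_mapP[y _ /IH <-] ->].
Qed.

Lemma nbrs_l1 x y : y \in nbrs x -> l1 x y = 1%N.
Proof.
move=> /flatten_mapP[i _]; have := l1_zshift x i 1 x; have := l1_zshift x i (-1) x.
rewrite l1xx !inE (l1C x) => h1 h2 /orP[] /eqP ->; lia.
Qed.

Lemma walks_l1 n x s y : s \in walks n x -> y \in s -> (l1 x y <= n)%N.
Proof.
elim: n x s y => [|n IH] x s y /=.
  by rewrite inE => /eqP ->; rewrite inE => /eqP ->; rewrite l1xx.
move=> /mapP[s' /flatten_mapP[z /nbrs_l1 xz /IH h] ->].
rewrite inE => /orP[/eqP ->|/h]; first by rewrite l1xx.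
by have := l1_triangle z x y; lia.
Qed.

Definition connects (O : pred (Zd d)) (r : nat) x : Prop :=
  exists p, [/\ path nnb x p, all O (x :: p) & (r <= l1 x (last x p))%N].

(** Discrete intermediate value property: a step changes the distance to [x] by at most one. *)
Lemma path_hits_sphere x z p r : path nnb z p -> (l1 x z <= r)%N ->
  (r <= l1 x (last z p))%N -> exists p1 p2, p = p1 ++ p2 /\ l1 x (last z p1) = r.
Proof.
elim: p z => [|y p IH] z /=; first by move=> _ h1 h2; exists [::], [::]; split=> //=; lia.
move=> /andP[zy yp] h1 h2; have [e|ne] := eqVneq (l1 x z) r.
  by exists [::], (y :: p).
have zy1 : l1 z y = 1%N by apply/eqP.
have [|p1 [p2 [-> h]]] := IH y yp _ h2; first by have := l1_triangle z x y; lia.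
by exists (y :: p1), p2.
Qed.

Lemma path_l1_le x p : path nnb x p -> (l1 x (last x p) <= size p)%N.
Proof.
elim: p x => [|y p IH] x /=; first by rewrite l1xx.
move=> /andP[/eqP xy /IH]; rewrite -/(l1 x y) in xy.
by have := l1_triangle y x (last y p); lia.
Qed.

(** Cut the path where it meets the sphere of radius [3r]: the first piece goes beyond distance [r],
    and the second must still climb from [3r] to [4r], hence ends at distance at least [r] from the
    cut point. *)
Lemma connects_split (O : pred (Zd d)) r x : connects O (4 * r) x ->
  connects O r x /\ exists y, l1 x y = (3 * r)%N /\ connects O r y.
Proof.
move=> [p [xp Op rp]].
have [||p1 [p2 [pE h]]] := @path_hits_sphere x x p (3 * r) xp; [by rewrite l1xx|lia|].
move: xp Op rp; rewrite pE cat_path last_cat /= all_cat => /andP[P1 P2] /and3P[Ox O1 O2] rp.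
split; first by exists p1; split=> //=; [rewrite Ox|lia].
exists (last x p1); split=> //; exists p2; split=> //=.
  rewrite O2 andbT; have := mem_last x p1; rewrite inE => /orP[/eqP -> //|].
  exact: (allP O1).
by have := l1_triangle (last x p1) x (last (last x p1) p2); lia.
Qed.

(** Loop erasure keeps the endpoint, so the simple path still has at least [N + 1] steps; its first
    [N] steps form the walk. *)
Lemma connects_walk (O : pred (Zd d)) N x : connects O N.+1 x ->
  exists2 s, s \in walks N x & uniq s && all O s.
Proof.
move=> [p [+ Op]]; move=> xp; move: (xp); case/shortenP: xp => p' xp' up' sub _ Np.
have sz : (N.+1 <= size p')%N by apply: leq_trans Np (path_l1_le _ _ xp').
exists (x :: take N p').
  have := mem_walks x (take N p') ltac:(by apply: take_path).
  by rewrite size_takel// ltnW.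
apply/andP; split.
  move: up' => /=/andP[xp'' up'']; rewrite take_uniq// andbT.
  by apply: contra xp''; exact: mem_take.
move: Op => /=/andP[-> /allP Op]; apply/allP => y /mem_take yp'.
exact/Op/sub.
Qed.

End Lattice.

(** * Size, separation, energy and number of the trees *)

Section Covering.
Context {d : nat}.
Variable N : nat.
Implicit Types x y z : Zd d.

(* [cov k x] lists the vertex sets of the binary trees of paths rooted at [x]:
   some tree is open whenever [x] is connected to distance [4 ^ k * N]. *)
Fixpoint cov (k : nat) x : seq (seq (Zd d)) :=
  if k is k'.+1 then
    flatten [seq [seq s1 ++ s2 | s1 <- cov k' x, s2 <- cov k' y]
            | y <- sphere x (3 * (4 ^ k' * N))]
  else [seq s <- walks N.-1 x | uniq s].

Lemma covS k x s : reflect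
  (exists y s1 s2, [/\ y \in sphere x (3 * (4 ^ k * N)), s1 \in cov k x,
     s2 \in cov k y & s = s1 ++ s2])
  (s \in cov k.+1 x).
Proof.
apply: (iffP flatten_mapP) => [[y yS /allpairsP[[s1 s2] /= [h1 h2 ->]]]|[y [s1 [s2 [yS h1 h2 ->]]]]].
  by exists y, s1, s2.
by exists y => //; apply/allpairsP; exists (s1, s2).
Qed.

Hypothesis N_gt0 : (0 < N)%N.

Lemma connects_cov (O : pred (Zd d)) k x : connects O (4 ^ k * N) x ->
  exists2 s, s \in cov k x & all O s.
Proof.
elim: k x => [|k IH] x.
  rewrite expn0 mul1n -{1}(prednK N_gt0) => /connects_walk[s sw /andP[us Os]].
  by exists s; rewrite // mem_filter us.
rewrite expnS -mulnA => /connects_split[/IH[s1 h1 O1] [y [xy /IH[s2 h2 O2]]]].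
exists (s1 ++ s2); last by rewrite all_cat O1.
by apply/covS; exists y, s1, s2; split=> //; exact: mem_sphere.
Qed.

Lemma cov_size k x s : s \in cov k x -> size s = (2 ^ k * N)%N.
Proof.
elim: k x s => [|k IH] x s.
  by rewrite mem_filter => /andP[_ /walks_size ->]; rewrite prednK// mul1n.
move=> /covS[y [s1 [s2 [_ /IH h1 /IH h2 ->]]]].
by rewrite size_cat h1 h2 expnS; lia.
Qed.

Lemma cov_l1 k x s y : s \in cov k x -> y \in s -> (l1 x y < 4 ^ k * N)%N.
Proof.
elim: k x s => [|k IH] x s.
  by rewrite mem_filter => /andP[_ sw] /(walks_l1 _ _ _ _ sw); rewrite mul1n; lia.
move=> /covS[z [s1 [s2 [/sphere_l1 xz /IH h1 /IH h2 ->]]]].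
rewrite mem_cat expnS -mulnA => /orP[/h1|/h2]; first by move=> h; lia.
by have := l1_triangle z x y; lia.
Qed.

(** Each tree stays within distance [4^k N] of its root, and the roots are three times as far
    apart. *)
Lemma cov_sep k x y s1 s2 p q : s1 \in cov k x -> s2 \in cov k y ->
  l1 x y = (3 * (4 ^ k * N))%N -> p \in s1 -> q \in s2 -> (4 ^ k * N <= l1 p q)%N.
Proof.
move=> /cov_l1 h1 /cov_l1 h2 xy /h1 hp /h2 hq.
have := l1_triangle p x y; have := l1_triangle q p y; rewrite (l1C q y).
by lia.
Qed.

Variable R : realType.

(** The path containing [p] gives [1 + N gam], its sites being distinct. Joining at level [k] adds
    [2^k N] sites at distance at least [4^k N], contributing at most
    [2^k N / (4^k N)^2 <= 2^-k / N]. The last term of the bound is the partial sum of this geometric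
    series. *)
Lemma cov_energy (g : Zd d -> Zd d -> R) (gam : R) :
  (forall x y, g x y <= (x == y)%:R + gam) ->
  (forall x y r, (N <= r)%N -> (r <= l1 x y)%N -> g x y <= (r%:R ^+ 2)^-1) ->
  forall k x s p, s \in cov k x -> p \in s ->
  \sum_(q <- s) g p q <= 1 + N%:R * gam + (2 - 2 * (1 / 2) ^+ k) / N%:R.
Proof.
move=> near far; elim=> [|k IH] x s p.
  rewrite mem_filter => /andP[us sw] ps.
  rewrite expr0 mulr1 subrr mul0r addr0.
  apply: le_trans (_ : \sum_(q <- s) ((p == q)%:R + gam) <= _); first by apply: ler_sum.
  rewrite big_split /= lerD//.
    rewrite (bigD1_seq p)//= eqxx big1 ?addr0// => q.
    by rewrite eq_sym => /negbTE ->.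
  by rewrite big_const_seq count_predT iter_addr_0 (walks_size _ _ _ sw) prednK// mulr_natl.
have NR : 0 < N%:R :> R by rewrite ltr0n.
have cross s2 p' y : s2 \in cov k y -> (forall q, q \in s2 -> (4 ^ k * N <= l1 p' q)%N) ->
    \sum_(q <- s2) g p' q <= (1 / 2) ^+ k / N%:R.
  move=> /cov_size sz sep.
  apply: le_trans (_ : \sum_(q <- s2) ((4 ^ k * N)%:R ^+ 2)^-1 <= _).
    rewrite big_seq [leRHS]big_seq; apply: ler_sum => q qs.
    by apply: far; [rewrite leq_pmull ?expn_gt0|exact: sep].
  rewrite big_const_seq count_predT iter_addr_0 sz -[leLHS]mulr_natl !natrM !natrX.
  have h2 : 1 <= 2 ^+ k :> R by rewrite exprn_ege1//; lra.
  have -> : 4 ^+ k = 2 ^+ k * 2 ^+ k :> R by rewrite -exprMn; congr (_ ^+ _); lra.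
  rewrite div1r exprVn.
  move: (2 ^+ k) h2 => t t1.
  rewrite (_ : t * N%:R * _ = (t ^+ 2)^-1 * (t^-1 / N%:R)); last by field; lra.
  rewrite ler_piMl ?divr_ge0 ?invr_ge0//; first lra.
  by rewrite invf_le1 ?exprn_ege1// exprn_gt0; lra.
have e : (2 - 2 * (1 / 2) ^+ k.+1) / N%:R =
    (2 - 2 * (1 / 2) ^+ k) / N%:R + (1 / 2) ^+ k / N%:R :> R by rewrite exprS; field; lra.
move=> /covS[y [s1 [s2 [/sphere_l1 xy h1 h2 ->]]]].
rewrite mem_cat big_cat /= e addrA => /orP[ps|ps].
  apply: lerD; first exact: IH h1 ps.
  by apply: (cross _ _ _ h2) => q; exact: cov_sep h1 h2 xy ps.
rewrite addrC; apply: lerD; first exact: IH h2 ps.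
apply: (cross _ _ _ h1) => q qs; rewrite l1C.
exact: cov_sep h1 h2 xy qs ps.
Qed.

(* Multiplying through by [K ^+ (k + 2)] turns the recursion
   [c_(k+1) <= K ^+ (k + 1) * c_k ^ 2] into [b_(k+1) <= b_k ^ 2]. *)
Lemma cov_count (K : R) : (0 < d)%N -> 1 <= K ->
  (forall k x, (size (sphere x (3 * (4 ^ k * N))))%:R <= K ^+ k.+1) ->
  forall k x, (size (cov k x))%:R * K ^+ k.+2 <= ((d * 2)%:R ^+ N * K ^+ 2) ^+ (2 ^ k).
Proof.
move=> d0 K1 sph; elim=> [|k IH] x.
  rewrite expn0 expr1 ler_wpM2r ?exprn_ge0//; first lra.
  apply: le_trans (_ : (size (walks N.-1 x))%:R <= _).
    by rewrite ler_nat size_filter count_size.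
  rewrite size_walks natrX; case: N N_gt0 => // n _ /=.
  by rewrite ler_weXn2l// ler1n; lia.
set b := _ * K ^+ 2 in IH *.
have K0 m : 0 < K ^+ m by rewrite exprn_gt0; lra.
have sz y : (size (cov k y))%:R <= b ^+ (2 ^ k) / K ^+ k.+2 by rewrite ler_pdivlMr.
set c := b ^+ (2 ^ k) / K ^+ k.+2 in sz.
have c0 : 0 <= c by apply: le_trans (sz x).
have szS : (size (cov k.+1 x))%:R <= (size (sphere x (3 * (4 ^ k * N))))%:R * (c * c).
  rewrite /=; elim: (sphere _ _) => [|y s IHs]; first by rewrite mul0r.
  rewrite /= size_cat natrD size_allpairs natrM -natr1 mulrDl mul1r addrC lerD//.
  by apply: ler_pM.
apply: le_trans (ler_wpM2r (ltW (K0 _)) szS) _.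
apply: le_trans (_ : K ^+ k.+1 * (c * c) * K ^+ k.+3 <= _).
  by rewrite ler_wpM2r ?(ltW (K0 _))// ler_wpM2r ?(mulr_ge0 c0 c0)//.
rewrite expnSr exprM expr2 le_eqVlt; apply/orP; left; apply/eqP.
have -> : b ^+ (2 ^ k) = c * K ^+ k.+2 by rewrite /c divfK// gt_eqF.
have -> : K ^+ k.+3 = K * K ^+ k.+2 by rewrite exprS.
have -> : K ^+ k.+2 = K * K ^+ k.+1 by rewrite exprS.
by ring.
Qed.

End Covering.

(** * Probability estimates *)

Local Open Scope classical_set_scope.
Local Open Scope ring_scope.

(** Recentre the density at [a]: for [x >= a >= 0] one has [x^2 >= a^2 + (x - a)^2], and the
    recentred law has mass at most 1. *)
Lemma normal_prob_tail (R : realType) (s a : R) : 0 < s -> 0 <= a ->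
  (normal_prob 0 s `[a, +oo[ <= (expR (- a ^+ 2 / (s ^+ 2 *+ 2)))%:E)%E.
Proof.
move=> s0 a0; have sn0 : s != 0 by rewrite gt_eqF.
set c := expR _.
apply: (@le_trans _ _ (c%:E * normal_prob a s `[a, +oo[)%E); last first.
  rewrite -[leRHS]mule1; apply: lee_wpmul2l; first by rewrite lee_fin expR_ge0.
  exact: (@probability_le1 _ _ _ (normal_prob a s)).
rewrite /normal_prob -ge0_integralZl_EFin ?expR_ge0//=; last 2 first.
- by move=> x _; rewrite lee_fin normal_pdf_ge0.
- by apply/measurable_EFinP; apply: measurable_funTS; exact: measurable_normal_pdf.
apply: ge0_le_integral => //=.
- by move=> x _; rewrite lee_fin normal_pdf_ge0.
- by apply/measurable_EFinP; apply: measurable_funTS; exact: measurable_normal_pdf.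
- apply/measurable_EFinP; apply: measurable_funM => //.
  by apply: measurable_funTS; exact: measurable_normal_pdf.
move=> x; rewrite in_itv/= andbT => ax.
rewrite lee_fin !normal_pdfE// mulrCA ler_wpM2l ?normal_peak_ge0//.
rewrite /normal_fun -expRD ler_expR -mulrDl ler_wpM2r//.
  by rewrite invr_ge0 mulrn_wge0// sqr_ge0.
nra.
Qed.

(** * Union bound and measurability of crossings *)

Section UnionBound.
Context {disp : measure_display} {T : measurableType disp} {R : realType}.
Variable P : probability T R.

Lemma union_bound {I : eqType} (S : seq I) (E : I -> set T) (A : set T) (b : R) :
  measurable A -> (forall s, measurable (E s)) ->
  (forall s, s \in S -> (P (E s) <= b%:E)%E) ->
  A `<=` [set w | exists2 s, s \in S & E s w] ->
  (P A <= ((size S)%:R * b)%:E)%E.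
Proof.
move=> mA mE; elim: S A mA => [|s S IH] A mA H sub.
  rewrite mul0r (_ : A = set0) ?measure0// -subset0 => w /sub[s]; by rewrite in_nil.
have AE : A `<=` E s `|` (A `\` E s) by move=> w Aw; have [?|?] := pselect (E s w); [left|right].
apply: (@le_trans _ _ (P (E s) + P (A `\` E s))%E).
  apply: (@le_trans _ _ (P (E s `|` (A `\` E s)))).
    by apply: le_measure; rewrite ?inE//; apply: measurableU => //; exact: measurableD.
  by apply: measureU2 => //; exact: measurableD.
rewrite [size _]/= -natr1 mulrDl mul1r addrC EFinD leeD// ?H ?mem_head//.
apply: IH; first exact: measurableD.
  by move=> s' s'S; apply: H; rewrite inE s'S orbT.
move=> w [/sub[s']]; rewrite inE => /orP[/eqP -> //|s'S Es' _]; by exists s'.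
Qed.

Context {d : nat}.
Variable phi : Zd d -> T -> R.

(** Lists replace functions on [nat] because they form a countable type: a crossing becomes a
    countable union of finite intersections, hence measurable. *)
Lemma crossing_path h L w : crossing phi h L w <->
  exists xp : Zd d * seq (Zd d),
    [/\ (linf xp.1 <= L)%N, linf (last xp.1 xp.2) = (2 * L)%N, path nnb xp.1 xp.2 &
      all (fun y => h <= phi y w) (xp.1 :: xp.2)].
Proof.
split=> [[n [gam [h0 hn hstep hphi]]]|[[x p] [h0 hn hp /allP hphi]]]; last move: h0 hn hp hphi => /= h0 hn hp hphi.
  exists (gam 0%N, [seq gam k | k <- iota 1 n]) => /=.
  have lst m : last (gam 0%N) [seq gam k | k <- iota 1 m] = gam m.
    by case: m => [//|m]; rewrite -(addn1 m) iotaD map_cat last_cat /= addnC.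
  split=> //; first by rewrite lst.
    elim: n {hn} hstep {hphi} => [//|n IH] hstep.
    rewrite -(addn1 n) iotaD map_cat cat_path IH => [|k kn]; last by apply: hstep; lia.
    by rewrite lst /= add1n andbT; apply: hstep.
  rewrite (hphi 0%N)//=; apply/allP => y /mapP[k]; rewrite mem_iota => kn ->.
  by apply: hphi; lia.
exists (size p), (nth x (x :: p)); split=> //.
- by rewrite -last_nth.
- by move=> k kn; exact: (pathP x hp).
- by move=> k kn; apply: hphi; apply: mem_nth.
Qed.

Hypothesis mphi : forall x, measurable_fun setT (phi x).

Lemma measurable_crossing h L : measurable (crossing phi h L).
Proof.
have -> : crossing phi h L = \bigcup_(xp in [set xp : Zd d * seq (Zd d) |
    [/\ (linf xp.1 <= L)%N, linf (last xp.1 xp.2) = (2 * L)%N & path nnb xp.1 xp.2]])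
    \big[setI/setT]_(y <- xp.1 :: xp.2) (phi y @^-1` `[h, +oo[).
  apply/seteqP; split=> w.
    move=> /crossing_path[xp [h1 h2 h3 h4]]; exists xp => //.
    rewrite -bigcap_seq => y /= yxp; rewrite in_itv/= andbT; exact: (allP h4).
  move=> [xp [h1 h2 h3]]; rewrite -bigcap_seq => h4; apply/crossing_path; exists xp; split=> //.
  by apply/allP => y yxp; have := h4 y yxp; rewrite /= in_itv/= andbT.
rewrite bigcup_mkcond; apply: countable_bigcupT_measurable => [|xp].
  exact: countableP.
case: ifP => // _; apply: bigsetI_measurable => y _; rewrite -[X in measurable X]setTI; exact: mphi.
Qed.

Lemma crossing_cov h L N k w : (0 < N)%N -> (4 ^ k * N <= L)%N -> crossing phi h L w ->
  exists2 s, s \in flatten [seq cov N k x | x <- box L] & all (fun y => h <= phi y w) s.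
Proof.
move=> N0 kL /crossing_path[[x p] /= [h1 h2 h3 h4]].
have /(connects_cov _ N0)[s sc Os] : connects (fun y => h <= phi y w) (4 ^ k * N) x.
  exists p; split=> //; apply: leq_trans kL _.
  set z := last x p in h2 *.
  (* The endpoints have sup norms at most [L] and exactly [2L], so their l1 distance is at least
     [L]. *)
  have : (linf z <= linf x + l1 x z)%N.
    apply/bigmax_leqP => i _.
    apply: (@leq_trans (absz (x i) + absz (x i - z i))%N); first lia.
    by rewrite leq_add// ?(leq_bigmax (F := fun i => absz (x i)))// /l1 (bigD1 i)//= leq_addr.
  lia.
exists s => //; apply/flatten_mapP; exists x => //; apply: mem_box => i.
by apply: leq_trans h1; exact: (leq_bigmax (F := fun i => absz (x i))).
Qed.

End UnionBound.

(** * Gaussian tail for sums of the field *)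

Section GFF.
Context {disp : measure_display} {T : measurableType disp} {R : realType}.
Variable P : probability T R.
Context {d : nat}.
Variable phi : Zd d -> T -> R.
Hypothesis gff : is_GFF P phi.

(** The unit weights put the sum in the form of the linear combinations in [is_GFF]. *)
Definition sum_event (a : R) (s : seq (Zd d)) : set T :=
  (fun w => \sum_(p <- [seq (y, 1 : R) | y <- s]) p.2 * phi p.1 w) @^-1` `[a, +oo[.

Lemma measurable_sum_event a s : measurable (sum_event a s).
Proof.
rewrite -[X in measurable X]setTI.
have mf : measurable_fun setT (fun w => \sum_(p <- [seq (y, 1 : R) | y <- s]) p.2 * phi p.1 w).
  apply: measurable_sum => p; apply: measurable_funM => //; exact: gff.1.
exact: mf.
Qed.

Lemma sum_event_tail a s V : 0 < a ->
  0 < \sum_(p <- s) \sum_(q <- s) fine (green R d p q) <= V ->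
  (P (sum_event a s) <= (expR (- a ^+ 2 / (V *+ 2)))%:E)%E.
Proof.
move=> a0 /andP[v0 vV]; rewrite /sum_event gff.2//.
have -> : \sum_(p <- [seq (y, 1 : R) | y <- s]) \sum_(q <- [seq (y, 1 : R) | y <- s])
   p.2 * q.2 * fine (green R d p.1 q.1) = \sum_(p <- s) \sum_(q <- s) fine (green R d p q).
  rewrite big_map; apply: eq_bigr => p _; rewrite big_map; apply: eq_bigr => q _.
  by rewrite /= !mul1r.
move: v0 vV; set v := \sum_(p <- s) _ => v0 vV.
rewrite /centered_gauss_law gt_eqF//.
apply: le_trans (normal_prob_tail _ _ _ _ _) _; [by rewrite sqrtr_gt0|exact: ltW|].
rewrite lee_fin ler_expR sqr_sqrtr ?(ltW v0)// !mulNr lerN2.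
rewrite ler_wpM2l ?sqr_ge0// lef_pV2 ?posrE ?pmulrn_lgt0//; last exact: lt_le_trans vV.
by rewrite ler_pMn2r.
Qed.

End GFF.

(** * Decay of the crossing probability *)

Lemma scale_bracket (N L : nat) : (0 < N)%N -> (N <= L)%N ->
  exists k, (4 ^ k * N <= L < 4 ^ k.+1 * N)%N.
Proof.
move=> N0; elim: L => [|L IH]; first by rewrite leqn0 => /eqP N00; rewrite N00 in N0.
rewrite leq_eqVlt => /orP[/eqP <-|/IH[k /andP[h1 h2]]].
  by exists 0%N; lia.
case: (ltnP L.+1 (4 ^ k.+1 * N)) => h; first by exists k; rewrite h andbT; lia.
by exists k.+1; rewrite h (expnS 4 k.+1); lia.
Qed.

(** Apply [size_sphere_le] with [m = 4^(k+1)]; then [2(m + 1) <= 4^(k+2) <= 16^(k+1)]. *)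
Lemma size_sphere_scale (R : realType) d (x : Zd d) N k : (N <= d)%N ->
  (size (sphere x (3 * (4 ^ k * N))))%:R <= ((16 * expR 1) ^+ d) ^+ k.+1 :> R.
Proof.
move=> Nd; have k4 : (0 < 4 ^ k.+1)%N by rewrite expn_gt0.
apply: le_trans (size_sphere_le R x _ _ k4 _) _.
  by rewrite expnS -mulnA leq_mul// leq_mul.
rewrite -exprM mulnC exprM lerXn2r ?nnegrE ?exprn_ge0 ?mulr_ge0 ?expR_ge0//.
have e1 : 1 <= expR 1 :> R by rewrite -expR0 ler_expR.
rewrite exprMn mulrC ler_pM ?expR_ge0//.
  rewrite -natrX -natrM ler_nat.
  apply: (@leq_trans (4 * 4 ^ k.+1)%N); first lia.
  by rewrite -expnS (_ : 16 = 4 ^ 2)%N// -expnM leq_exp2l//; lia.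
by rewrite ler_eXnr.
Qed.

Section CrossingBound.
Context {disp : measure_display} {T : measurableType disp} {R : realType}.
Variable P : probability T R.
Context {d : nat}.
Variable phi : Zd d -> T -> R.
Hypothesis gff : is_GFF P phi.
Variables (N : nat) (h V gam : R).
Hypotheses (d_gt0 : (0 < d)%N) (N_gt0 : (0 < N)%N) (Nd : (N <= d)%N) (h_gt0 : 0 < h).
Hypothesis green_ge0 : forall x y, 0 <= fine (green R d x y).
Hypothesis green_diag : forall x, 1 <= fine (green R d x x).
Hypothesis green_near : forall x y, fine (green R d x y) <= (x == y)%:R + gam.
Hypothesis green_far : forall x y r, (N <= r)%N -> (r <= l1 x y)%N ->
  fine (green R d x y) <= (r%:R ^+ 2)^-1.
Hypothesis V_ge : 1 + N%:R * gam + 2 / N%:R <= V.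

Let K : R := (16 * expR 1) ^+ d.

(** On an open tree of [M = 2^k N] sites the field sums to at least [M h], with variance at most
    [M V]. The tail [exp(-M h^2 / (2V))] is then multiplied by the number of roots and of trees. *)
Lemma crossing_bound k L : (4 ^ k * N <= L)%N ->
  (P (crossing phi h L) <= ((2 * L).+1%:R ^+ d *
    ((d * 2)%:R ^+ N * K ^+ 2 * expR (- (N%:R * h ^+ 2 / (V *+ 2)))) ^+ (2 ^ k))%:E)%E.
Proof.
move=> kL; have NR : 0 < N%:R :> R by rewrite ltr0n.
set S := flatten [seq cov N k x | x <- box L] : seq (seq (Zd d)).
have K1 : 1 <= K.
  have e1 : 1 <= expR 1 :> R by rewrite -expR0 ler_expR.
  by rewrite /K exprn_ege1//; lra.
set M : R := (2 ^ k * N)%:R.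
have M0 : 0 < M by rewrite ltr0n muln_gt0 expn_gt0.
have energy s : s \in S -> size s = (2 ^ k * N)%N /\
    0 < \sum_(p <- s) \sum_(q <- s) fine (green R d p q) <= M * V.
  move=> /flatten_mapP[x _ sx]; have sz := cov_size _ N_gt0 _ _ _ sx; split=> //.
  apply/andP; split.
    have [p ps] : exists p, p \in s.
      case: (s) sz => [/esym/eqP|p s' _]; last by exists p; exact: mem_head.
      by rewrite muln_eq0 expn_eq0/= gtn_eqF.
    rewrite (big_rem p)//= ltr_pwDl//; last by rewrite sumr_ge0// => *; exact: sumr_ge0.
    rewrite (big_rem p)//= ltr_pwDl//; last by rewrite sumr_ge0.
    exact: lt_le_trans (green_diag p).
  apply: le_trans (_ : \sum_(p <- s) V <= _).
    rewrite big_seq [leRHS]big_seq; apply: ler_sum => p ps.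
    apply: le_trans (cov_energy _ N_gt0 _ _ _ green_near green_far _ _ _ _ sx ps) _.
    apply: le_trans V_ge; rewrite lerD2l ler_wpM2r ?invr_ge0 ?(ltW NR)//.
    have : 0 <= (1 / 2) ^+ k :> R by rewrite exprn_ge0.
    lra.
  by rewrite big_const_seq count_predT iter_addr_0 sz mulr_natl.
set b := expR (- (N%:R * h ^+ 2 / (V *+ 2))).
have V0 : 0 < V.
  apply: lt_le_trans V_ge; rewrite -addrA ltr_pwDl// addr_ge0 ?mulr_ge0 ?invr_ge0 ?(ltW NR)//.
  (* Two distinct points show [gam >= 0]. *)
  have := green_near (orig d) (zshift (orig d) (Ordinal d_gt0) 1).
  rewrite (_ : (_ == _) = false) ?add0r; last first.
    by apply/negbTE/eqP => /ffunP /(_ (Ordinal d_gt0)); rewrite !ffunE eqxx.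
  by apply: le_trans.
have bound : (P (crossing phi h L) <= ((size S)%:R * b ^+ (2 ^ k))%:E)%E.
  apply: (union_bound P S (sum_event phi (M * h))).
  - by apply: measurable_crossing; exact: gff.1.
  - exact: measurable_sum_event gff _.
  - move=> s /energy[sz v].
    apply: le_trans (sum_event_tail P phi gff _ _ _ (mulr_gt0 M0 h_gt0) v) _.
    rewrite lee_fin -expRM_natl ler_expR le_eqVlt; apply/orP; left; apply/eqP.
    have t0 : 0 < (2 ^ k)%:R :> R by rewrite ltr0n expn_gt0.
    rewrite /M natrM !mulr2n; move: (_ ^ k)%:R t0 => t t0; field.
    by rewrite !gt_eqF// addr_gt0 ?mulr_gt0.
  - move=> w /(crossing_cov _ _ _ _ _ _ N_gt0 kL)[s sS /allP Os]; exists s => //.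
    have [sz _] := energy s sS.
    rewrite /sum_event /= in_itv/= andbT big_map.
    apply: le_trans (_ : \sum_(p <- s) h <= _).
      by rewrite big_const_seq count_predT iter_addr_0 sz mulr_natl.
    by rewrite big_seq [leRHS]big_seq; apply: ler_sum => p ps; rewrite mul1r Os.
apply: le_trans bound _; rewrite lee_fin exprMn mulrA ler_wpM2r ?exprn_ge0 ?expR_ge0//.
set B := _ ^+ (2 ^ k).
have cnt x : (size (cov N k x : seq (seq (Zd d))))%:R <= B.
  apply: le_trans (_ : (size (cov N k x))%:R * K ^+ k.+2 <= _).
    by rewrite ler_peMr// exprn_ege1.
  by apply: cov_count => // k' x'; exact: size_sphere_scale.
rewrite -natrX -(size_box (d := d)) /S; elim: (box L) => [|x s IH]; first by rewrite mul0r.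
by rewrite /= size_cat natrD -natr1 mulrDl mul1r addrC lerD.
Qed.

Lemma crossing_cvg0 :
  (d * 2)%:R ^+ N * K ^+ 2 * expR (- (N%:R * h ^+ 2 / (V *+ 2))) <= expR (-1) ->
  (fun L : nat => P (crossing phi h L)) @ \oo --> 0%E.
Proof.
move=> small; have mc L : measurable (crossing phi h L).
  by apply: measurable_crossing; exact: gff.1.
apply/fine_cvgP; split; first by apply: nearW => L; exact: fin_num_measure.
apply/cvgrPdist_le => e e0.
(* With [L < 4^(k+1) N] the number of roots is at most [(8N)^d (2^k)^(2d)], against a tree factor
   [exp(-2^k)]. *)
have [x0 Hx] := @pow_le_expR R ((8 * N%:R) ^+ d / e) (2 * d).
exists (4 ^ x0 * N)%N => // L /= L0.
have NL : (N <= L)%N by apply: leq_trans L0; rewrite leq_pmull// expn_gt0.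
have [k /andP[k1 k2]] := scale_bracket N L N_gt0 NL.
have x0k : (x0 <= k)%N.
  rewrite -ltnS -(@ltn_exp2l 4)//.
  by rewrite -(ltn_pmul2r N_gt0); apply: leq_ltn_trans k2.
rewrite sub0r normrN ger0_norm; last exact: fine_ge0.
rewrite -lee_fin fineK; last exact: fin_num_measure.
apply: le_trans (crossing_bound k L k1) _; rewrite lee_fin.
apply: le_trans (_ : (8 * N%:R * (2 ^ k)%:R ^+ 2) ^+ d * expR (-1) ^+ (2 ^ k) <= _).
  apply: ler_pM.
  - by rewrite exprn_ge0.
  - by rewrite exprn_ge0// mulr_ge0 ?expR_ge0// mulr_ge0 ?exprn_ge0// /K exprn_ge0// mulr_ge0 ?expR_ge0.
  - rewrite lerXn2r ?nnegrE ?mulr_ge0 ?exprn_ge0//.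
    rewrite -natrX -!natrM ler_nat -expnM mulnC.
    rewrite (_ : 2 ^ (k * 2) = 4 ^ k)%N; last by rewrite mulnC expnM.
    by move: k2; rewrite expnS; lia.
  - rewrite lerXn2r ?nnegrE ?expR_ge0//.
    by rewrite mulr_ge0 ?expR_ge0// mulr_ge0 ?exprn_ge0// /K exprn_ge0// mulr_ge0 ?expR_ge0.
rewrite -expRM_natl mulrN1 expRN exprMn -exprM.
rewrite ler_pdivrMr ?expR_gt0//.
have k2k : (x0 <= 2 ^ k)%N by apply: leq_trans x0k _; rewrite ltnW// ltn_expl.
have {Hx} := Hx (2 ^ k)%:R; rewrite ler_nat => /(_ k2k).
by rewrite -ler_pdivrMl// mulrA [_^-1 * _]mulrC.
Qed.

End CrossingBound.

(* The factor [(16 e) ^ (2 d)], which counts the positions of the branch points,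
   is beaten by [d ^ (- eps N)] as soon as [N] is of order [d]. *)
Lemma leaf_cost_le (R : realType) (eps : R) (m d N : nat) :
  0 < eps -> (0 < d)%N -> (d <= 2 * m * N)%N -> (0 < N)%N ->
  (2 + 20 * m%:R) / eps <= ln d%:R ->
  (d * 2)%:R ^+ N * ((16 * expR 1) ^+ d) ^+ 2 * expR (- ((1 + eps) * N%:R * ln d%:R))
    <= expR (-1) :> R.
Proof.
move=> e0 d0 dmN N0 hln.
have NR : 1 <= N%:R :> R by rewrite ler1n.
have dR : 0 < d%:R :> R by rewrite ltr0n.
have dmNR : d%:R <= 2 * m%:R * N%:R :> R by rewrite -!natrM ler_nat.
have e2 : 2 <= expR 1 :> R by apply: le_trans (expR_ge1Dx _); lra.
have K5 : 16 * expR 1 <= expR 5 :> R.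
  rewrite (_ : 5 = 4%:R * 1 + 1 :> R); last lra.
  rewrite expRD ler_wpM2r ?expR_ge0// expRM_natl.
  apply: le_trans (_ : 2 ^+ 4 <= _); first lra.
  by rewrite lerXn2r ?nnegrE ?expR_ge0.
have h1 : (d * 2)%:R ^+ N <= expR (N%:R * ln d%:R + N%:R) :> R.
  rewrite natrM exprMn expRD ler_pM ?exprn_ge0//.
    by rewrite expRM_natl lnK ?posrE.
  by rewrite -[leRHS](congr1 expR (mulr1 _)) expRM_natl lerXn2r ?nnegrE ?expR_ge0.
have h2 : ((16 * expR 1) ^+ d) ^+ 2 <= expR (10 * d%:R) :> R.
  rewrite -exprM; apply: le_trans (_ : expR 5 ^+ (d * 2) <= _).
    by rewrite lerXn2r ?nnegrE ?mulr_ge0 ?expR_ge0.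
  by rewrite -expRM_natl ler_expR natrM; lra.
apply: le_trans (ler_wpM2r (expR_ge0 _) (ler_pM _ _ h1 h2)) _.
- by rewrite exprn_ge0.
- by rewrite !exprn_ge0// mulr_ge0 ?expR_ge0.
rewrite -!expRD ler_expR.
(* The exponent is [N + 10 d - eps N ln d], and [hln] gives [eps N ln d >= 2 N + 20 m N >= N + 1 +
   10 d]. *)
move: hln; rewrite ler_pdivrMr// => hln.
nra.
Qed.

(** * Choice of parameters and conclusion *)

Lemma crossing_cvg0_asymptotic (R : realType) (eps : R) : 0 < eps ->
  exists d0 : nat, forall (d : nat) (disp : measure_display) (T : measurableType disp)
    (P : probability T R) (phi : Zd d -> T -> R), (d0 <= d)%N -> is_GFF P phi ->
  0 < h_as R d /\
  (fun L : nat => P (crossing phi ((1 + eps) * h_as R d) L)) @ \oo --> 0%E.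
Proof.
move=> e0; have [n0 Hn0] := green_sums_le R.
(* With [N] close to [d / m], [m] makes [3N/d <= eps/2] and [n1] makes [2/N <= eps/2], so
   [V = 1 + eps] is allowed; [n2] makes [ln d] large enough for [leaf_cost_le]. *)
pose m := (Num.truncn (6 / eps)).+1.
have mE : 6 / eps <= m%:R by apply: ltW; exact: truncnS_gt.
pose n1 := (Num.truncn (4 / eps)).+1.
have n1E : 4 / eps <= n1%:R by apply: ltW; exact: truncnS_gt.
pose n2 := (Num.truncn (expR ((2 + 20 * m%:R) / eps))).+1.
have n2E : expR ((2 + 20 * m%:R) / eps) <= n2%:R by apply: ltW; exact: truncnS_gt.
pose n3 := maxn n1 (maxn n0 2).
exists (maxn n2 (maxn n0 (m * n3))) => d disp T P phi.
rewrite !geq_max => /and3P[dn2 dn0 dmn] gff.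
pose N := (d %/ m)%N.
have n3N : (n3 <= N)%N by rewrite leq_divRL// mulnC.
have [n1N n0N N2] : [/\ (n1 <= N)%N, (n0 <= N)%N & (2 <= N)%N].
  by move: n3N; rewrite !geq_max => /and3P.
have N0 : (0 < N)%N by lia.
have Nd : (N <= d)%N by exact: leq_div.
have d_gt0 : (0 < d)%N by lia.
have mNd : (m * N <= d)%N by rewrite mulnC leq_trunc_div.
have dmN : (d <= 2 * m * N)%N.
  have : (d < N.+1 * m)%N by rewrite ltn_ceil.
  by nia.
have NR : 0 < N%:R :> R by rewrite ltr0n.
have dR : 0 < d%:R :> R by rewrite ltr0n.
have [near far] := Hn0 d dn0.
have gpos x y : 0 <= fine (green R d x y).
  by have /andP[] := green_le R x y _ (near x y).
have gnear x y : fine (green R d x y) <= (x == y)%:R + 3 / d%:R.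
  by have /andP[] := green_le R x y _ (near x y).
have gfar x y r : (N <= r)%N -> (r <= l1 x y)%N -> fine (green R d x y) <= (r%:R ^+ 2)^-1.
  move=> Nr rxy; have H M := far x y r M (leq_trans n0N Nr) rxy.
  by have /andP[] := green_le R x y _ H.
have gdiag x : 1 <= fine (green R d x x) by apply: (green_diag_ge1 R x _ (near x x)).
have g1 : 1 <= g0 R d by exact: gdiag.
have hln : (2 + 20 * m%:R) / eps <= ln d%:R.
  rewrite -ler_expR lnK ?posrE//; apply: le_trans n2E _; by rewrite ler_nat.
have ln0 : 0 < ln (d%:R : R).
  by apply: lt_le_trans hln; rewrite divr_gt0// ltr_wpDr// mulr_ge0.
have has0 : 0 < h_as R d by rewrite /h_as sqrtr_gt0 !mulr_gt0//; lra.
split=> //.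
have V_ge : 1 + N%:R * (3 / d%:R) + 2 / N%:R <= 1 + eps.
  have a : N%:R * (3 / d%:R) <= eps / 2.
    rewrite mulrA ler_pdivrMr//.
    have : m%:R * N%:R <= d%:R :> R by rewrite -natrM ler_nat.
    move: mE; rewrite ler_pdivrMr//; nra.
  have b : 2 / N%:R <= eps / 2.
    rewrite ler_pdivrMr//; have : n1%:R <= N%:R :> R by rewrite ler_nat.
    move: n1E; rewrite ler_pdivrMr//; nra.
  lra.
have h_gt0 : 0 < (1 + eps) * h_as R d by rewrite mulr_gt0//; lra.
apply: (crossing_cvg0 P phi gff N _ (1 + eps) (3 / d%:R)) => //.
apply: le_trans (leaf_cost_le R eps m d N e0 d_gt0 dmN N0 hln).
rewrite ler_wpM2l//.
(* Here [h^2 / (2V) = (1 + eps) g0 ln d], and [g0 >= 1]. *)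
rewrite ler_expR lerN2 exprMn /h_as sqr_sqrtr; last by rewrite !mulr_ge0//; lra.
rewrite ler_pdivlMr; last by rewrite pmulrn_lgt0//; lra.
rewrite -mulr_natr.
have h1 : ln d%:R <= g0 R d * ln d%:R by rewrite ler_peMl// ltW.
have c0 : 0 <= 2 * N%:R * (1 + eps) ^+ 2 :> R by rewrite !mulr_ge0 ?exprn_ge0//; lra.
have := ler_wpM2l c0 h1; move: (ln _) (g0 _ _) => l g; lra.
Qed.

Theorem theorem1p2 (R : realType) (dT : nat -> measure_display)
    (T : forall d, measurableType (dT d))
    (P : forall d, probability (T d) R) (phi : forall d, Zd d -> T d -> R) :
  (forall d, (3 <= d)%N -> is_GFF (P d) (phi d)) ->
  (limn_esup (ratio_seq P phi) <= 1%:E)%E.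
Proof.
move=> gff; apply/lee_addgt0Pr => eps e0.
have [d0 H] := crossing_cvg0_asymptotic R eps e0.
rewrite limn_esup_lim.
have -> : limn (esups (ratio_seq P phi)) = ereal_inf (range (esups (ratio_seq P phi))).
  by apply: cvg_lim => //; exact: cvg_esups_inf.
(* The limsup is at most the supremum over [d >= max(d0, 3)], a range free of the default value 0 of
   [ratio_seq]. *)
apply: le_trans (ereal_inf_lbound _) (_ : (esups (ratio_seq P phi) (maxn d0 3) <= _)%E).
  by exists (maxn d0 3).
apply: ub_ereal_sup => _ [d /= dd <-]; move: dd; rewrite geq_max => /andP[dd0 d3].
rewrite /ratio_seq d3.
have [has0 cv] := H d _ _ (P d) (phi d) dd0 (gff d d3).
have hss : (h_ss (P d) (phi d) <= ((1 + eps) * h_as R d)%:E)%E.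
  by apply: ereal_inf_lbound; exists ((1 + eps) * h_as R d).
apply: le_trans (lee_wpmul2r _ hss) _; first by rewrite lee_fin invr_ge0 ltW.
by rewrite -EFinM mulfK ?gt_eqF// EFinD.
Qed.
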